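(* Let $\alpha$ be a partition with all parts $\ge 2$ and overlapping partition $p=(p_1,\dots,p_{\ell(\alpha)-1},0)$, and for $1\le i\le \ell(p)-1$ let $\varrho_i=1+\sum_{q=i+1}^{\ell(\alpha)}\alpha_q-p_{i+1}$. Then $[R_\alpha^p]=[\alpha,(|\alpha|-p_1,p_1)]$ if and only if either $\ell(p)<2$, or $\ell(p)\ge2$ and $$\sum_{j=1}^i[\varrho_i-\alpha_j]_+\ge p_{i+1}\quad\text{for every } 1\le i\le \ell(p)-1.$$
   Context: A partition $\alpha=(\alpha_1\ge\dots\ge\alpha_{\ell(\alpha)}>0)$ has length $\ell(\alpha)$ and size $|\alpha|$. A ribbon is a skew Young diagram (English convention) containing no $2\times2$ square. For a partition $\alpha$ with all parts $\ge2$, a ribbon $R_\alpha$ has rows, from top to bottom, of lengths $\alpha_1,\dots,\alpha_{\ell(\alpha)}$, consecutive rows sharing at most one column and non-consecutive rows sharing none. Its overlapping partition is $p=(p_1,\dots,p_{\ell(\alpha)-1},0)$ where $p_i$ is the number of columns of length two in the last $\ell(\alpha)-i+1$ rows; $\ell(p)$ is the number of nonzero parts of $p$. The ribbon is determined by $(\alpha,p)$ and denoted $R_\alpha^p$. For a skew shape $A$, $s_A=\sum_\nu c_A^\nu s_\nu$ and the Schur support is $[A]=\{\nu:c_A^\nu>0\}$. $\preceq$ is dominance order and $[\lambda,\mu]=\{\nu:\lambda\preceq\nu\preceq\mu\}$. For real $x$, $[x]_+=\max\{0,x\}$. *)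

(* Defs.v *)
From mathcomp Require Import all_boot all_order all_algebra.
From mathcomp Require Import mpoly.

Set Implicit Arguments.
Unset Strict Implicit.
Unset Printing Implicit Defensive.

Import Order.TTheory GRing.Theory Num.Theory.

Local Open Scope nat_scope.

Definition is_partition (s : seq nat) : bool := sorted geq s && (0 \notin s).

(* The entry with 1-based index [i], and 0 beyond the last entry; only used
   with [1 <= i]. *)
Definition part (s : seq nat) (i : nat) : nat := nth 0 s i.-1.

Definition num_nonzero (s : seq nat) : nat := count (fun x => 0 < x) s.

(* All partitions of [k]: they have at most [k] parts, each at most [k]. *)
Definition partitions (k : nat) : seq (seq nat) :=
  [seq s <- [seq map val t | t : k.-bseq 'I_k.+1 <- enum {: k.-bseq 'I_k.+1}]
     | is_partition s && (sumn s == k)].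

Lemma partitions_uniq k : uniq (partitions k).
Proof.
rewrite filter_uniq // map_inj_uniq ?enum_uniq // => s t /= eq_st.
by apply: val_inj; apply: (inj_map val_inj).
Qed.

Lemma mem_partitions k s :
  (s \in partitions k) = is_partition s && (sumn s == k).
Proof.
rewrite mem_filter andb_idr // => /andP[/andP[_ s_pos] /eqP sum_s].
have le_part x : x \in s -> x <= k.
  by rewrite -sum_s => xs; rewrite (perm_sumn (perm_to_rem xs)) leq_addr.
have le_size : size s <= k.
  rewrite -sum_s; elim: s s_pos {sum_s le_part} => //= x s IHs.
  by rewrite inE negb_or eq_sym -lt0n => /andP[x0 /IHs]; rewrite -add1n; apply: leq_add.
have size_t : size [seq inord x : 'I_k.+1 | x <- s] <= k by rewrite size_map.
apply/mapP; exists (Bseq size_t); first by rewrite mem_enum.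
rewrite /= -map_comp -[LHS]map_id; apply/eq_in_map => x xs /=.
by rewrite inordK // ltnS le_part.
Qed.

Definition dominated (lam nu : seq nat) : Prop :=
  sumn lam = sumn nu /\
  forall k : nat, sumn (take k lam) <= sumn (take k nu).

(* Trailing zeros in [lam] or [mu] do not affect the interval. *)
Definition in_dominance_interval (lam mu nu : seq nat) : Prop :=
  [/\ is_partition nu, dominated lam nu & dominated nu mu].

Definition is_skew_shape (lam mu : seq nat) : Prop :=
  [/\ is_partition lam, is_partition mu &
      forall i, 1 <= i -> part mu i <= part lam i].

(* The cells (row, column) of lam / mu, numbered from 1, in the English
   convention. *)
Definition diagram (lam mu : seq nat) : seq (nat * nat) :=
  [seq (i, j) | i <- iota 1 (size lam),
                j <- iota (part mu i).+1 (part lam i - part mu i)].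

Definition is_ssyt (D : seq (nat * nat)) (n : nat)
    (T : {ffun seq_sub D -> 'I_n}) : bool :=
  [forall x, forall y,
     (((val x).1 == (val y).1) && ((val x).2 < (val y).2) ==> (T x <= T y)) &&
     (((val x).2 == (val y).2) && ((val x).1 < (val y).1) ==> (T x < T y))].

Definition skew_schur (n : nat) (lam mu : seq nat) : {mpoly int[n]} :=
  (\sum_(T : {ffun seq_sub (diagram lam mu) -> 'I_n} | is_ssyt T)
     \prod_x 'X_(T x))%R.

Definition schur (n : nat) (nu : seq nat) : {mpoly int[n]} :=
  skew_schur n nu [::].

(* [c nu] is the coefficient of s_nu in s_{lam / mu}. An identity between
   symmetric functions is one that holds in every finite number of variables;
   as s_{lam / mu} is homogeneous, only the partitions of |lam / mu| occur. *)
Definition is_schur_expansion (lam mu : seq nat) (c : seq nat -> int) : Prop :=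
  let k := size (diagram lam mu) in
  (forall n : nat,
     skew_schur n lam mu = \sum_(nu <- partitions k) c nu *: schur n nu)%R /\
  (forall nu, nu \notin partitions k -> c nu = 0%R).

(* The Schur functions form a basis, so the expansion exists and is unique. *)
Definition in_schur_support (lam mu nu : seq nat) : Prop :=
  exists c : seq nat -> int, is_schur_expansion lam mu c /\ (0 < c nu)%R.

Definition no_2x2_square (D : seq (nat * nat)) : Prop :=
  forall i j, ~ [/\ (i, j) \in D, (i, j.+1) \in D,
                    (i.+1, j) \in D & (i.+1, j.+1) \in D].

Definition shared_columns (lam mu : seq nat) (r s : nat) : nat :=
  count (fun j => ((r, j) \in diagram lam mu) && ((s, j) \in diagram lam mu))
        (iota 1 (part lam 1)).

(* lam / mu is a ribbon with row lengths [alpha], from top to bottom. *)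
Definition is_ribbon (alpha lam mu : seq nat) : Prop :=
  [/\ is_skew_shape lam mu,
      no_2x2_square (diagram lam mu),
      alpha = [seq part lam i - part mu i | i <- iota 1 (size lam)],
      forall r, 1 <= r < size lam -> shared_columns lam mu r r.+1 <= 1 &
      forall r s, 1 <= r -> r.+1 < s <= size lam -> shared_columns lam mu r s = 0].

(* The number of cells of column [j] in the rows [i], [i.+1], ... *)
Definition column_length_from (lam mu : seq nat) (i j : nat) : nat :=
  count (fun x => (i <= x.1) && (x.2 == j)) (diagram lam mu).

Definition overlapping_partition (lam mu : seq nat) : seq nat :=
  [seq count (fun j => column_length_from lam mu i j == 2) (iota 1 (part lam 1))
     | i <- iota 1 (size lam)].

Definition pos_part (x : int) : int := Num.max 0%R x.

Definition varrho (alpha p : seq nat) (i : nat) : int :=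
  (1 + \sum_(i.+1 <= q < (size alpha).+1) (part alpha q)%:Z
     - (part p i.+1)%:Z)%R.

(* Main.v *)
Require Import Defs.
From mathcomp Require Import all_boot all_order all_algebra.
From mathcomp Require Import mpoly zify.

(** Reading the rows of the ribbon from top to bottom, each from right to left,
    turns its tableaux into words that are weakly decreasing along the rows and
    strictly increasing at the overlaps. Dropping an overlap condition, or
    replacing it by its opposite (which merges the two rows), gives a recursion
    that ends with products of complete homogeneous polynomials. Chains of
    horizontal strips satisfy the same recursion and, by the Pieri rule, the same
    initial conditions. Hence [c_nu] counts the chains
    [nu = nu^0 > nu^1 > ... > nu^l = 0] of horizontal strips of sizes
    [alpha_1, ..., alpha_l] in which every overlap forces a descent.

    With [A_i = alpha_i + ... + alpha_(l-1)] and [p_i] the number of overlaps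
    from row [i] on (indices from 0), such a chain exists if and only if [nu]
    dominates [alpha] and [nu_i + p_i <= A_i] for all [i]. Necessity holds because
    [nu_i] is at most the first row of [nu^i] and each descent puts a cell outside
    the first row. For sufficiency, [nu^1] is the most dominant partition that
    respects these bounds and misses the last cell of the last longest row of [nu].
    The inequality of the theorem for [i] says exactly that no partition that
    dominates [alpha] violates the bound at [i]. *)

Set Implicit Arguments.
Unset Strict Implicit.
Unset Printing Implicit Defensive.

Import Order.TTheory GRing.Theory Num.Theory.

Local Open Scope nat_scope.

Local Notation "s `_ i" := (nth 0 s i) : nat_scope.

(** * Counting and big operators *)

Lemma eq_count_bij (T1 T2 : eqType) (s1 : seq T1) (s2 : seq T2) (P : pred T1) (Q : pred T2)
    (f : T1 -> T2) (g : T2 -> T1) :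
    uniq s1 -> uniq s2 ->
    (forall x, x \in s1 -> P x -> [/\ f x \in s2, Q (f x) & g (f x) = x]) ->
    (forall y, y \in s2 -> Q y -> [/\ g y \in s1, P (g y) & f (g y) = y]) ->
  count P s1 = count Q s2.
Proof.
move=> uniq1 uniq2 fP gQ; rewrite -!size_filter -(size_map f).
apply/perm_size/uniq_perm; rewrite ?filter_uniq //.
  rewrite map_inj_in_uniq ?filter_uniq // => x y; rewrite !mem_filter.
  by case/andP=> Px /fP[//|_ _ gfx] /andP[Py /fP[//|_ _ gfy]] eq_f; rewrite -gfx eq_f.
move=> y; rewrite mem_filter; apply/mapP/andP => [[x]|[Qy /gQ[//|gs Pg fgy]]].
  by rewrite mem_filter => /andP[Px /fP[//|? ? _]] ->.
by exists (g y); rewrite ?mem_filter ?Pg.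
Qed.

Lemma sum_count_fibers (T : Type) (f : T -> nat) (s : seq T) j :
  \sum_(i < j) count (fun c => f c == i) s = count (fun c => f c < j) s.
Proof.
elim: s => [|c s IHs] /=; first by rewrite big1.
rewrite big_split IHs /=; congr (_ + _); case: (ltnP (f c) j) => [lt_j|le_j].
  rewrite (bigD1 (Ordinal lt_j)) //= eqxx big1 // => i; rewrite -val_eqE eq_sym /=.
  by move/negbTE ->.
by rewrite big1 // => i _; rewrite gtn_eqF // (leq_trans (ltn_ord i)).
Qed.

Lemma eq_big_seq_cond (R : Type) (idx : R) (op : Monoid.com_law idx) (I : eqType)
    (r : seq I) (P : pred I) (F G : I -> R) : (forall i, i \in r -> P i -> F i = G i) ->
  \big[op/idx]_(i <- r | P i) F i = \big[op/idx]_(i <- r | P i) G i.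
Proof.
move=> eqFG; rewrite big_seq_cond [RHS]big_seq_cond.
by apply: eq_bigr => i /andP[]; apply: eqFG.
Qed.

Lemma partition_big_seq (R : Type) (idx : R) (op : Monoid.com_law idx) (I : finType)
    (J : eqType) (r : seq J) (P : pred I) (Q : pred J) (h : I -> J) (F : I -> R) :
  uniq r -> (forall i, P i -> (h i \in r) && Q (h i)) ->
  \big[op/idx]_(i | P i) F i =
  \big[op/idx]_(j <- r | Q j) \big[op/idx]_(i | P i && (h i == j)) F i.
Proof.
move=> r_uniq hP; rewrite (exchange_big_dep P) /=; last by move=> j i _ /andP[].
apply: eq_bigr => i Pi; have /andP[hr Qh] := hP i Pi.
rewrite big_mkcond (bigD1_seq (h i)) //= Qh Pi eqxx big1 ?Monoid.mulm1 // => j ne_j.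
by rewrite eq_sym (negbTE ne_j) !andbF.
Qed.

Lemma big_seq_sub (R : Type) (idx : R) (op : Monoid.com_law idx) (T : choiceType)
    (D : seq T) (F : T -> R) : uniq D ->
  \big[op/idx]_(x : seq_sub D) F (val x) = \big[op/idx]_(c <- D) F c.
Proof.
move=> D_uniq; rewrite -[in RHS](val_seq_sub_enum D_uniq) big_map.
apply/perm_big/uniq_perm; rewrite ?index_enum_uniq ?undup_uniq // => x.
by rewrite mem_index_enum mem_seq_sub_enum.
Qed.

Lemma big_tuple_cons (R : Type) (idx : R) (op : Monoid.com_law idx) (T : finType) m
    (P : pred (m.+1.-tuple T)) (F : m.+1.-tuple T -> R) :
  \big[op/idx]_(t | P t) F t =
  \big[op/idx]_(a : T) \big[op/idx]_(t : m.-tuple T | P [tuple of a :: t])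
     F [tuple of a :: t].
Proof.
rewrite pair_big_dep /= (reindex (fun p : T * m.-tuple T => [tuple of p.1 :: p.2])) //=.
exists (fun t : m.+1.-tuple T => (thead t, [tuple of behead t])) => [[a t] _|t _] /=.
  by congr (_, _); apply: val_inj.
by rewrite -tuple_eta.
Qed.

(** * Sequences of natural numbers *)

Definition nonincreasing (f : nat -> nat) : Prop := forall i, f i.+1 <= f i.

Lemma nonincreasing_leq f i j : nonincreasing f -> i <= j -> f j <= f i.
Proof.
move=> f_dec; apply: (homo_leq (r := fun x y => y <= x)) => // y x z xy yz.
exact: leq_trans yz xy.
Qed.

Lemma nonincreasing_eq0 f i j : nonincreasing f -> i <= j -> f i = 0 -> f j = 0.
Proof. by move=> f_dec ij fi0; apply/eqP; rewrite -leqn0 -fi0 nonincreasing_leq. Qed.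

Lemma sum_ord_recl (f : nat -> nat) n : \sum_(i < n.+1) f i = f 0 + \sum_(i < n) f i.+1.
Proof. exact: big_ord_recl. Qed.

Lemma sum_ord_recr (f : nat -> nat) n : \sum_(i < n.+1) f i = \sum_(i < n) f i + f n.
Proof. exact: big_ord_recr. Qed.

Lemma leq_sum_ord_widen (f : nat -> nat) m n : m <= n ->
  \sum_(i < m) f i <= \sum_(i < n) f i.
Proof.
by move=> le_mn; rewrite (big_ord_widen n f le_mn) big_mkcond leq_sum // => i _; case: ifP.
Qed.

Lemma eq_sum_ord_widen (f : nat -> nat) m n : m <= n -> (forall i, m <= i -> f i = 0) ->
  \sum_(i < m) f i = \sum_(i < n) f i.
Proof.
move=> le_mn f0; rewrite (big_ord_widen n f le_mn) big_mkcond.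
by apply: eq_bigr => i _; case: ltnP => // /f0.
Qed.

Lemma sum_ord_le_const (f : nat -> nat) c n :
  (forall i, i < n -> f i <= c) -> \sum_(i < n) f i <= n * c.
Proof.
by move=> f_le; rewrite -[n in n * c]card_ord -sum_nat_const leq_sum // => i _; apply: f_le.
Qed.

Lemma sum_ord_ge_size (f : nat -> nat) m n : m <= n -> (forall i, m <= i < n -> 0 < f i) ->
  \sum_(i < m) f i + (n - m) <= \sum_(i < n) f i.
Proof.
elim: n => [|n IHn] le_mn f_gt0; first by case: m le_mn {f_gt0} => //; rewrite big_ord0.
case: (eqVneq m n.+1) => [->|ne_mn]; first by rewrite subnn addn0.
have {}le_mn : m <= n by lia.
have := IHn le_mn (fun i lt_i => f_gt0 i ltac:(lia)).
by have := f_gt0 n; rewrite sum_ord_recr; lia.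
Qed.

Lemma sum_ord_lt_exists (f g : nat -> nat) n :
  \sum_(i < n) f i < \sum_(i < n) g i -> exists2 i, i < n & f i < g i.
Proof.
move=> lt_sum; case: (boolP [exists i : 'I_n, f i < g i]) => [/existsP[i]|/existsPn ge_fg].
  by exists i.
by move: lt_sum; rewrite ltnNge leq_sum // => i _; rewrite leqNgt ge_fg.
Qed.

Lemma ltn_sum_ord (f g : nat -> nat) n i : (forall j, f j <= g j) -> i < n -> f i < g i ->
  \sum_(j < n) f j < \sum_(j < n) g j.
Proof.
move=> le_fg lt_i lt_fg.
rewrite (bigD1 (Ordinal lt_i)) //= [ltnRHS](bigD1 (Ordinal lt_i)) //=.
by rewrite -addSn leq_add // leq_sum.
Qed.

Lemma sum_nonincreasing_ge f n : nonincreasing f -> f 0 + n * f n <= \sum_(i < n.+1) f i.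
Proof.
move=> f_dec; rewrite sum_ord_recl leq_add2l.
elim: n => [|n IHn] //; rewrite (sum_ord_recr (fun i => f i.+1)) mulSn.
by have := leq_mul (leqnn n) (f_dec n); lia.
Qed.

Lemma sumn_take (s : seq nat) k : sumn (take k s) = \sum_(i < k) s`_i.
Proof.
elim: s k => [|x s IHs] [|k]; rewrite ?big_ord0 //=.
  by rewrite big1 // => i _; rewrite nth_nil.
by rewrite IHs (sum_ord_recl (nth 0 (x :: s))).
Qed.

Lemma sum_nth_sumn (s : seq nat) k : size s <= k -> \sum_(i < k) s`_i = sumn s.
Proof. by move=> le_sk; rewrite -sumn_take take_oversize. Qed.

Lemma leq_sum_nth_sumn (s : seq nat) k : \sum_(i < k) s`_i <= sumn s.
Proof. by rewrite -sumn_take -[in leqRHS](cat_take_drop k s) sumn_cat leq_addr. Qed.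

Lemma sum_nth_sumn_drop (s : seq nat) k : \sum_(i < k) s`_i + sumn (drop k s) = sumn s.
Proof. by rewrite -sumn_take -sumn_cat cat_take_drop. Qed.

Lemma sumn_drop_nth (s : seq nat) k : sumn (drop k s) = s`_k + sumn (drop k.+1 s).
Proof.
by apply/(@addnI (\sum_(i < k) s`_i)); rewrite addnA -sum_ord_recr !sum_nth_sumn_drop.
Qed.

Lemma sumn_drop (s : seq nat) k K : size s <= k + K ->
  sumn (drop k s) = \sum_(j < K) s`_(k + j).
Proof.
move=> le_sK; rewrite -(@sum_nth_sumn _ K) ?size_drop ?leq_subLR //.
by apply: eq_bigr => j _; rewrite nth_drop.
Qed.

Lemma sumn_drop_ge (s : seq nat) c k :
  all (leq c) s -> c * (size s - k) <= sumn (drop k s).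
Proof.
rewrite -{1}(cat_take_drop k s) all_cat -size_drop => /andP[_].
elim: (drop k s) => [|x t IHt] /=; first by rewrite muln0.
by case/andP=> cx /IHt; rewrite mulnS; lia.
Qed.

Lemma sorted_nth_ltn s m i : sorted leq s -> i < size s ->
  (s`_i < m) = (i < count (gtn m) s).
Proof.
move=> s_sorted lt_i; have [lt_c|ge_c] := ltnP i (count (gtn m) s).
  exact: nth_count_lt s_sorted lt_c.
by apply/negbTE; rewrite -leqNgt; apply: (nth_count_ge _ s_sorted); rewrite lt_i andbT.
Qed.

Lemma num_nonzero_ltn s i : nonincreasing (nth 0 s) -> (i < num_nonzero s) = (0 < s`_i).
Proof.
elim: s i => [|x s IHs] i s_dec; first by rewrite nth_nil.
have tail_dec : nonincreasing (nth 0 s) by move=> j; apply: (s_dec j.+1).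
rewrite /num_nonzero /= -/(num_nonzero s); case: (posnP x) => [x0|x_gt0]; last first.
  by case: i => [|i] //=; rewrite add1n ltnS IHs.
have s0 j : s`_j = 0 by apply: (nonincreasing_eq0 s_dec (leq0n j.+1)).
have num0 : num_nonzero s = 0 by apply/eqP; rewrite -leqn0 leqNgt IHs // s0.
by rewrite num0 x0 /=; case: i => [|i] /=; rewrite ?x0 ?s0.
Qed.

Definition greedy_fill (d : nat -> nat) E i := minn (d i) (E - \sum_(j < i) d j).

Lemma sum_greedy_fill d E k : \sum_(i < k) greedy_fill d E i = minn E (\sum_(i < k) d i).
Proof.
elim: k => [|k IHk]; first by rewrite !big_ord0 minn0.
by rewrite !sum_ord_recr IHk /greedy_fill; lia.
Qed.

Lemma greedy_fill_full d E i j :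
  i < j -> 0 < greedy_fill d E j -> greedy_fill d E i = d i.
Proof.
move=> lt_ij; have := leq_sum_ord_widen d lt_ij; rewrite sum_ord_recr /greedy_fill; lia.
Qed.

(** * Partitions *)

Lemma partition_nonincreasing s : is_partition s -> nonincreasing (nth 0 s).
Proof.
case/andP=> /(sortedP 0) sorted_s _ i.
by case: (ltnP i.+1 (size s)) => [/sorted_s|?] //; rewrite nth_default.
Qed.

Lemma partition_nth_leq s i j : is_partition s -> i <= j -> s`_j <= s`_i.
Proof. by move/partition_nonincreasing; apply: nonincreasing_leq. Qed.

Lemma partition_nth_gt0 s i : is_partition s -> (0 < s`_i) = (i < size s).
Proof.
case/andP=> _ s_pos; case: (ltnP i (size s)) => [lt_i|?]; last by rewrite nth_default.
by rewrite lt0n; apply: contra s_pos => /eqP <-; apply: mem_nth.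
Qed.

Lemma eq_partition s t : is_partition s -> is_partition t -> nth 0 s =1 nth 0 t -> s = t.
Proof.
move=> s_part t_part eq_st; apply: (@eq_from_nth _ 0) => [|i _]; last exact: eq_st.
have lt_size i : (i < size s) = (i < size t) by rewrite -!partition_nth_gt0 // eq_st.
by apply/eqP; rewrite eqn_leq leqNgt lt_size ltnn leqNgt -lt_size ltnn.
Qed.

Lemma size_partition_le s : is_partition s -> size s <= sumn s.
Proof.
by case/andP=> _; elim: s => //= x s IHs; rewrite inE negb_or => /andP[? /IHs]; lia.
Qed.

Lemma partition_sumn0 s : is_partition s -> sumn s = 0 -> s = [::].
Proof. by move/size_partition_le=> + s0; rewrite s0 leqn0 => /nilP. Qed.

Definition partition_of (f : nat -> nat) K : seq nat := [seq x <- mkseq f K | 0 < x].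

Section PartitionOf.
Variables (f : nat -> nat) (K : nat).
Hypotheses (f_dec : nonincreasing f) (fK : f K = 0).

Lemma partition_of_is_partition : is_partition (partition_of f K).
Proof.
rewrite /is_partition mem_filter andbT sorted_filter //.
  by move=> x y z /= xy yz; apply: leq_trans yz xy.
apply/(sortedP 0) => i; rewrite size_mkseq => lt_i.
by rewrite !nth_mkseq ?(ltnW lt_i) //; apply: f_dec.
Qed.

Lemma nth_partition_of i : (partition_of f K)`_i = f i.
Proof.
rewrite /partition_of /mkseq; elim: K f f_dec fK i => [|k IHk] g g_dec g0 i.
  by rewrite nth_nil (nonincreasing_eq0 g_dec (leq0n i)).
have tail_dec : nonincreasing (fun i => g i.+1) by move=> j; apply: g_dec.
rewrite /= (iotaDl 1) -map_comp; case: posnP => [g00|_].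
  by rewrite (IHk _ tail_dec) // !(nonincreasing_eq0 g_dec _ g00).
by case: i => [|i] //; apply: (IHk _ tail_dec).
Qed.

Lemma size_partition_of : size (partition_of f K) <= K.
Proof. by rewrite size_filter (leq_trans (count_size _ _)) ?size_mkseq. Qed.

Lemma sumn_partition_of : sumn (partition_of f K) = \sum_(i < K) f i.
Proof.
rewrite -(sum_nth_sumn size_partition_of).
by apply: eq_bigr => i _; rewrite nth_partition_of.
Qed.

End PartitionOf.

Definition partitions_upto M := undup (flatten [seq partitions k | k <- iota 0 M.+1]).

Lemma mem_partitions_upto M s : (s \in partitions_upto M) = is_partition s && (sumn s <= M).
Proof.
rewrite mem_undup; apply/flatten_mapP/andP => [[k]|[s_part s_le]].
  by rewrite mem_iota mem_partitions => ? /andP[-> /eqP ->]; lia.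
by exists (sumn s); rewrite ?mem_iota ?mem_partitions ?s_part ?eqxx //; lia.
Qed.

Lemma partitions_upto_uniq M : uniq (partitions_upto M).
Proof. exact: undup_uniq. Qed.

Lemma perm_partitions k M : k <= M ->
  perm_eq (partitions k) [seq s <- partitions_upto M | sumn s == k].
Proof.
move=> le_kM; apply: uniq_perm;
  rewrite ?partitions_uniq ?(filter_uniq _ (partitions_upto_uniq M)) // => s.
rewrite mem_partitions mem_filter mem_partitions_upto.
by case: eqP => [->|]; rewrite ?le_kM ?andbT ?andbF.
Qed.

Lemma perm_partitions0 : perm_eq (partitions 0) [:: [::]].
Proof.
apply: uniq_perm; rewrite ?partitions_uniq // => s; rewrite mem_partitions inE.
by apply/andP/eqP => [[? /eqP]|->] //; apply: partition_sumn0.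
Qed.

Lemma dominatedP s t :
  dominated s t <-> sumn s = sumn t /\ forall k, \sum_(i < k) s`_i <= \sum_(i < k) t`_i.
Proof. by split=> -[eq_sum dom]; split=> // k; have := dom k; rewrite !sumn_take. Qed.

Lemma dominated_anti s t : is_partition s -> is_partition t ->
  dominated s t -> dominated t s -> s = t.
Proof.
move=> s_part t_part /dominatedP[_ st] /dominatedP[_ ts]; apply: eq_partition => // i.
have eq_sum k : \sum_(j < k) s`_j = \sum_(j < k) t`_j by apply/eqP; rewrite eqn_leq st ts.
by apply/(@addnI (\sum_(j < i) s`_j)); rewrite {2}eq_sum -!sum_ord_recr.
Qed.

(** * Horizontal strips *)

Definition hstrip (nu ka : seq nat) : bool :=
  all (fun i => nu`_i.+1 <= ka`_i <= nu`_i) (iota 0 (size nu + size ka)).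

Lemma hstripP nu ka : reflect (forall i, nu`_i.+1 <= ka`_i <= nu`_i) (hstrip nu ka).
Proof.
apply: (iffP allP) => [strip i|strip i _]; last exact: strip.
case: (ltnP i (size nu + size ka)) => [lt_i|?]; first by apply: strip; rewrite mem_iota.
by rewrite !nth_default //; lia.
Qed.

Lemma hstrip_le nu ka i : hstrip nu ka -> ka`_i <= nu`_i.
Proof. by move/hstripP/(_ i)/andP=> []. Qed.

Lemma hstrip_ge nu ka i : hstrip nu ka -> nu`_i.+1 <= ka`_i.
Proof. by move/hstripP/(_ i)/andP=> []. Qed.

Lemma hstrip_sumn_dropS nu ka k : hstrip nu ka -> sumn (drop k.+1 nu) <= sumn (drop k ka).
Proof.
move=> strip; pose K := size nu + size ka.
rewrite (@sumn_drop nu _ K) ?(@sumn_drop ka _ K) /K; try lia.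
by apply: leq_sum => j _; rewrite addSn hstrip_ge.
Qed.

Lemma hstrip_sumn_drop nu ka k : hstrip nu ka -> sumn (drop k ka) <= sumn (drop k nu).
Proof.
move=> strip; pose K := size nu + size ka.
rewrite (@sumn_drop nu _ K) ?(@sumn_drop ka _ K) /K; try lia.
by apply: leq_sum => j _; apply: hstrip_le.
Qed.

Lemma hstrip_sumn_drop_ltn nu ka k j :
  hstrip nu ka -> k <= j -> ka`_j < nu`_j -> sumn (drop k ka) < sumn (drop k nu).
Proof.
move=> strip le_kj lt_j; pose K := j.+1 + size nu + size ka.
rewrite (@sumn_drop nu _ K) ?(@sumn_drop ka _ K) /K; try lia.
apply: (@ltn_sum_ord (fun i => ka`_(k + i)) (fun i => nu`_(k + i)) _ (j - k));
  rewrite ?subnKC //; last by lia.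
by move=> i; apply: hstrip_le.
Qed.

Lemma hstrip_dominated nu ka (s : seq nat) a : hstrip nu ka -> sumn nu = sumn ka + a ->
  dominated s ka -> dominated (a :: s) nu.
Proof.
move=> strip size_nu /dominatedP[size_s dom]; apply/dominatedP; split=> [|[|k]].
- by rewrite /= size_nu size_s addnC.
- by rewrite !big_ord0.
have := hstrip_sumn_dropS k strip; have := sum_nth_sumn_drop nu k.+1.
have := sum_nth_sumn_drop ka k; have := dom k.
by rewrite (sum_ord_recl (nth 0 (a :: s))) /=; lia.
Qed.

Lemma hstrip_sumn nu ka : hstrip nu ka -> sumn ka <= sumn nu.
Proof. by move/(hstrip_sumn_drop 0); rewrite !drop0. Qed.

(* The strip [rho / nu] has a cell in a lower row than some cell of [nu / ka]: in
   the standardization of the chain, the last entry of [nu / ka] is a descent. *)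
Definition strip_descent (ka nu rho : seq nat) : bool :=
  has (fun j => (nu`_j < rho`_j) && has (fun i => ka`_i < nu`_i) (iota 0 j))
    (iota 0 (size rho)).

Lemma strip_descentP ka nu rho :
  reflect (exists i j, [/\ i < j, ka`_i < nu`_i & nu`_j < rho`_j])
    (strip_descent ka nu rho).
Proof.
apply: (iffP hasP) => [[j _ /andP[lt_j /hasP[i]]]|[i [j [lt_ij lt_i lt_j]]]].
  by rewrite mem_iota => lt_ij; exists i, j.
exists j; last by rewrite lt_j; apply/hasP; exists i; rewrite ?mem_iota.
by rewrite mem_iota ltnNge; apply: contraL lt_j => /(nth_default 0) ->.
Qed.

Lemma strip_descentPn ka nu rho i j :
  ~~ strip_descent ka nu rho -> i < j -> ka`_i < nu`_i -> rho`_j <= nu`_j.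
Proof.
move=> no_descent lt_ij lt_i; rewrite leqNgt; apply: contra no_descent => lt_j.
by apply/strip_descentP; exists i, j.
Qed.

(** * The Pieri rule *)

Section LocalRule.
Variables (nu ka : seq nat) (a : nat).
Hypotheses (nu_part : is_partition nu) (ka_part : is_partition ka).

Let upper i := maxn nu`_i ka`_i.
Let lower i := minn nu`_i ka`_i.
Let K := (size nu + size ka).+1.

Let upper_lower i : upper i.+1 <= lower i -> lower i.+1 <= upper i.+1 <= lower i.
Proof. by rewrite /upper /lower; lia. Qed.

Let upper0 i : K <= i.+1 -> upper i = 0.
Proof. by rewrite /K /upper => ?; rewrite !nth_default; lia. Qed.

Let lower0 i : K <= i.+1 -> lower i = 0.
Proof. by rewrite /K /lower => ?; rewrite !nth_default; lia. Qed.

(* [s / _] and [t / _] are strips common to [nu] and [ka] from inside and from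
   outside; apart from the first row of [t], both conditions put each row in the
   same interval. *)
Let innerP s :
  reflect (forall i, upper i.+1 <= s`_i <= lower i) (hstrip nu s && hstrip ka s).
Proof.
apply: (iffP andP) => [[/hstripP nu_s /hstripP ka_s] i|bound].
  by have := nu_s i; have := ka_s i; rewrite /upper /lower; lia.
by split; apply/hstripP => i; have := bound i; rewrite /upper /lower; lia.
Qed.

Let outerP t :
  reflect (upper 0 <= t`_0 /\ forall i, upper i.+1 <= t`_i.+1 <= lower i)
    (hstrip t nu && hstrip t ka).
Proof.
apply: (iffP andP) => [[/hstripP t_nu /hstripP t_ka]|[bound0 bound]].
  split=> [|i]; first by have := t_nu 0; have := t_ka 0; rewrite /upper; lia.
  have := t_nu i; have := t_ka i; have := t_nu i.+1; have := t_ka i.+1.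
  by rewrite /upper /lower; lia.
split; apply/hstripP => -[|i]; have := bound 0; rewrite /upper /lower in bound0 bound *;
  by [lia | have := bound i; have := bound i.+1; lia].
Qed.

(* The local rule of the Robinson-Schensted-Knuth correspondence: each row is
   reflected in the interval of its admissible values. *)
Let reflected s t := forall i, t`_i.+1 + s`_i = upper i.+1 + lower i.

Let reflected_sumn s t : reflected s t ->
  sumn t + sumn s + upper 0 = sumn nu + sumn ka + t`_0.
Proof.
move=> refl; pose N := K + size s + size t.
have sum_rows : \sum_(i < N) t`_i.+1 + sumn s =
    \sum_(i < N) upper i.+1 + \sum_(i < N) lower i.
  rewrite -(@sum_nth_sumn s N) /N; last by lia.
  by rewrite -!big_split; apply: eq_bigr => i _; apply: refl.
have sum_t : sumn t = t`_0 + \sum_(i < N) t`_i.+1.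
  by rewrite -sum_ord_recl sum_nth_sumn // /N; lia.
have sum_upper : upper 0 + \sum_(i < N) upper i.+1 = \sum_(i < N) upper i.
  by rewrite -sum_ord_recl sum_ord_recr upper0 ?addn0 // /N; lia.
have : \sum_(i < N) upper i + \sum_(i < N) lower i = sumn nu + sumn ka.
  rewrite -(@sum_nth_sumn nu N) -1?(@sum_nth_sumn ka N) /N /K; try lia.
  by rewrite -!big_split; apply: eq_bigr => i _; rewrite /upper /lower /=; lia.
lia.
Qed.

Let outward_rows s i := if i is j.+1 then upper j.+1 + lower j - s`_j
                        else upper 0 + (sumn s + a - sumn ka).
Let inward_rows t i := upper i.+1 + lower i - t`_i.+1.

Let outward s := partition_of (outward_rows s) K.
Let inward t := partition_of (inward_rows t) K.

Let nth_outward s : hstrip nu s && hstrip ka s ->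
  is_partition (outward s) /\ forall i, (outward s)`_i = outward_rows s i.
Proof.
move/innerP=> bound; have rows_dec : nonincreasing (outward_rows s).
  case=> [|i] /=; first by have := bound 0; rewrite /upper /lower; lia.
  have := bound i; have := bound i.+1; have := @upper_lower i.
  by have := @upper_lower i.+1; lia.
have rows0 : outward_rows s K = 0.
  by rewrite [LHS]/= upper0 ?lower0 //; apply: leqnSn.
by split; [apply: partition_of_is_partition | apply: nth_partition_of].
Qed.

Let nth_inward t : hstrip t nu && hstrip t ka ->
  is_partition (inward t) /\ forall i, (inward t)`_i = inward_rows t i.
Proof.
case/outerP=> _ bound; have rows_dec : nonincreasing (inward_rows t).
  move=> i; have := bound i; have := bound i.+1; have := @upper_lower i.
  by have := @upper_lower i.+1; rewrite /inward_rows; lia.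
have rows0 : inward_rows t K = 0.
  by rewrite /inward_rows upper0 ?lower0 //; lia.
by split; [apply: partition_of_is_partition | apply: nth_partition_of].
Qed.

Lemma local_rule_count :
  count (fun s => [&& hstrip nu s, hstrip ka s & sumn ka <= sumn s + a])
    (partitions_upto (sumn nu))
  = count (fun t => hstrip t nu && hstrip t ka) (partitions (sumn nu + a)).
Proof.
apply: (eq_count_bij (f := outward) (g := inward));
  rewrite ?partitions_upto_uniq ?partitions_uniq //.
- move=> s; rewrite mem_partitions_upto andbA => /andP[s_part s_le] /andP[inner le_ka].
  have [out_part nth_out] := nth_outward inner; have /innerP bound := inner.
  have refl : reflected s (outward s) by move=> i; rewrite nth_out /=; have := bound i; lia.
  have outer : hstrip (outward s) nu && hstrip (outward s) ka.
    by apply/outerP; split=> [|i]; rewrite nth_out /=; [lia | have := bound i; lia].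
  have [in_part nth_in] := nth_inward outer.
  split=> //.
    rewrite mem_partitions out_part; have := reflected_sumn refl.
    by rewrite nth_out /=; lia.
  by apply: eq_partition => // i; rewrite nth_in /inward_rows; have := refl i; lia.
- move=> t; rewrite mem_partitions => /andP[t_part /eqP t_sum] outer.
  have [in_part nth_in] := nth_inward outer; have /outerP[bound0 bound] := outer.
  have refl : reflected (inward t) t.
    by move=> i; rewrite nth_in /inward_rows; have := bound i; lia.
  have inner : hstrip nu (inward t) && hstrip ka (inward t).
    by apply/innerP => i; rewrite nth_in /inward_rows; have := bound i; lia.
  have [out_part nth_out] := nth_outward inner; have := reflected_sumn refl => sum_rows.
  split; first by rewrite mem_partitions_upto in_part hstrip_sumn //; case/andP: inner.
    by rewrite andbA inner /=; lia.
  by apply: eq_partition => // -[|i]; rewrite nth_out /=; [lia | have := refl i; lia].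
Qed.

End LocalRule.

Local Open Scope ring_scope.

Lemma big_partitions_range (R : nmodType) s a M (P : pred (seq nat)) (F : seq nat -> R) :
    (s + a <= M)%N ->
  \sum_(i < a.+1) \sum_(ka <- partitions (s + i) | P ka) F ka
  = \sum_(ka <- partitions_upto M | P ka && (s <= sumn ka <= s + a)%N) F ka.
Proof.
move=> le_M.
transitivity (\sum_(i < a.+1) \sum_(ka <- partitions_upto M | P ka)
    if sumn ka == (s + i)%N then F ka else 0).
  apply: eq_bigr => i _; have le_iM : (s + i <= M)%N by have := ltn_ord i; lia.
  rewrite (perm_big _ (perm_partitions le_iM)) big_filter_cond -big_mkcondr /=.
  by apply: eq_bigl => ka; rewrite andbC.
rewrite exchange_big [RHS]big_mkcondr /=; apply: eq_bigr => ka _.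
case: ifPn => [range|out]; last first.
  by rewrite big1 // => i _; case: eqP => //; have := ltn_ord i; lia.
have lt_a : (sumn ka - s < a.+1)%N by lia.
rewrite (bigD1 (Ordinal lt_a)) //= ifT ?big1 ?addr0 //; last by lia.
by move=> i; rewrite -val_eqE /= => ne_i; case: eqP => //; lia.
Qed.

Section BranchingSchur.
Variables (R : comNzRingType) (x : nat -> R).

(* The branching rule: [ka] is the shape of the entries below [m]. *)
Fixpoint branching_schur (n : nat) (nu : seq nat) : R :=
  if n is m.+1 then
    \sum_(ka <- partitions_upto (sumn nu) | hstrip nu ka)
      x m ^+ (sumn nu - sumn ka) * branching_schur m ka
  else (nu == [::])%:R.

Fixpoint complete_homogeneous (n a : nat) : R :=
  if n is m.+1 then \sum_(i < a.+1) x m ^+ (a - i) * complete_homogeneous m i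
  else (a == 0%N)%:R.

Lemma branching_schur_nil n : branching_schur n [::] = 1.
Proof.
elim: n => //= n IHn.
rewrite big_mkcond (perm_big [:: [::]]) /=; first by rewrite big_seq1 IHn mulr1.
apply: uniq_perm; rewrite ?partitions_upto_uniq // => s.
rewrite mem_partitions_upto inE leqn0.
by apply/andP/eqP => [[s_part /eqP]|->] //; apply: partition_sumn0.
Qed.

Lemma complete_homogeneous0 n : complete_homogeneous n 0 = 1.
Proof. by elim: n => [|n IHn] //=; rewrite big_ord1 IHn mulr1. Qed.

Lemma complete_homogeneousS n a :
  complete_homogeneous n.+1 a.+1 =
  complete_homogeneous n a.+1 + x n * complete_homogeneous n.+1 a.
Proof.
rewrite /= big_ord_recr /= subnn mul1r addrC; congr (_ + _).
rewrite mulr_sumr; apply: eq_bigr => i _; rewrite mulrA -exprS; congr (_ ^+ _ * _).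
by have := ltn_ord i; lia.
Qed.

Lemma sum_complete_homogeneous n a :
  \sum_(m < n) x m * complete_homogeneous m.+1 a = complete_homogeneous n a.+1.
Proof.
elim: n => [|n IHn]; first by rewrite big_ord0.
by rewrite big_ord_recr [in LHS]/= IHn complete_homogeneousS.
Qed.

Let pieri0 a nu : is_partition nu ->
  complete_homogeneous 0 a * branching_schur 0 nu =
  \sum_(ka <- partitions (sumn nu + a) | hstrip ka nu) branching_schur 0 ka.
Proof.
move=> nu_part; case: (posnP (sumn nu + a)) => [/eqP|sum_gt0].
  rewrite addn_eq0 => /andP[/eqP/(partition_sumn0 nu_part) -> /eqP ->].
  by rewrite (perm_big _ perm_partitions0) big_cons big_nil /= mulr1 addr0.
rewrite /= -natrM mulnb; case: andP => [[/eqP a0 /eqP nu0]|_].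
  by move: sum_gt0; rewrite a0 nu0.
rewrite big1_seq // => ka /andP[_]; rewrite mem_partitions => /andP[_ /eqP ka_sum].
by case: eqP => // ka0; move: sum_gt0; rewrite -ka_sum ka0.
Qed.

Lemma pieri n a nu : is_partition nu ->
  complete_homogeneous n a * branching_schur n nu =
  \sum_(ka <- partitions (sumn nu + a) | hstrip ka nu) branching_schur n ka.
Proof.
elim: n a nu => [|n IHn] a nu nu_part; first exact: pieri0.
pose M := (sumn nu + a)%N; pose weight ka := x n ^+ (M - sumn ka) * branching_schur n ka.
transitivity (\sum_(s <- partitions_upto (sumn nu) | hstrip nu s)
    \sum_(ka <- partitions_upto M | hstrip ka s && (sumn ka <= sumn s + a)%N) weight ka).
  rewrite [LHS]/= mulr_sumr; apply: eq_big_seq_cond => s.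
  rewrite mem_partitions_upto => /andP[s_part s_le] _.
  transitivity
    (\sum_(i < a.+1) \sum_(ka <- partitions (sumn s + i) | hstrip ka s) weight ka).
    rewrite mulr_suml; apply: eq_bigr => i _; have lt_i := ltn_ord i.
    rewrite mulrACA -exprD IHn // mulr_sumr; apply: eq_big_seq_cond => ka.
    by rewrite mem_partitions /weight /M => /andP[_ /eqP ->] _; congr (_ ^+ _ * _); lia.
  rewrite (@big_partitions_range _ _ _ M) /M ?leq_add2r //; apply: eq_bigl => ka.
  by case: (boolP (hstrip ka s)) => // /hstrip_sumn ->.
transitivity (\sum_(t <- partitions M | hstrip t nu)
    \sum_(ka <- partitions_upto M | hstrip t ka) weight ka); last first.
  apply: eq_big_seq_cond => t; rewrite mem_partitions => /andP[_ /eqP t_sum] _.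
  by rewrite /= t_sum.
rewrite (exchange_big_dep predT) //= [RHS](exchange_big_dep predT) //=.
apply: eq_big_seq_cond => ka; rewrite mem_partitions_upto => /andP[ka_part _] _.
by rewrite !big_const_seq local_rule_count.
Qed.

End BranchingSchur.

Local Close Scope ring_scope.

(** * Tableaux as functions on cells *)

Lemma mem_diagram lam mu i j :
  ((i, j) \in diagram lam mu) = (0 < i) && (part mu i < j <= part lam i).
Proof.
apply/allpairsPdep/andP => [[i' [j' [i'P j'P [-> ->]]]]|[i_gt0 jP]].
  by move: i'P j'P; rewrite !mem_iota; lia.
exists i, j; rewrite !mem_iota; split=> //; last by lia.
rewrite i_gt0 /= add1n ltnS leqNgt; apply/negP => lt_i.
by move: jP; rewrite /part (nth_default 0 (_ : size lam <= i.-1)); lia.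
Qed.

Lemma diagram_uniq lam mu : uniq (diagram lam mu).
Proof.
by apply: allpairs_uniq_dep => [|i _|]; rewrite ?iota_uniq // => -[i j] [i' j'] _ _ [-> ->].
Qed.

Lemma size_diagram lam mu :
  size (diagram lam mu) = sumn [seq part lam i - part mu i | i <- iota 1 (size lam)].
Proof. by rewrite size_allpairs_dep; under eq_map do rewrite size_iota. Qed.

Section Filling.
Variables (D : seq (nat * nat)) (n : nat).
Implicit Types (T : {ffun seq_sub D -> 'I_n}) (c : nat * nat).

Definition filling T c : nat := if insub c is Some y then val (T y) else 0.

Lemma fillingE T (y : seq_sub D) : filling T (val y) = T y.
Proof. by rewrite /filling valK. Qed.

Lemma filling_ltn T c : c \in D -> filling T c < n.
Proof. by move=> cD; rewrite -[c]/(val (SeqSub cD)) fillingE. Qed.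

Lemma eq_filling T T' : {in D, filling T =1 filling T'} -> T = T'.
Proof.
by move=> eqT; apply/ffunP => y; apply: ord_inj; rewrite -!fillingE eqT ?(valP y).
Qed.

Lemma ssytP T : reflect
  ((forall i j j', (i, j) \in D -> (i, j') \in D -> j < j' ->
      filling T (i, j) <= filling T (i, j')) /\
   (forall i i' j, (i, j) \in D -> (i', j) \in D -> i < i' ->
      filling T (i, j) < filling T (i', j)))
  (is_ssyt T).
Proof.
apply: (iffP forallP) => [ssyt|[row_le col_lt] [[i j] ijD]].
  split=> [i j j'|i i' j] cD cD' lt_cc';
  have /forallP/(_ (SeqSub cD'))/andP[/implyP row_le /implyP col_lt] := ssyt (SeqSub cD).
    by rewrite (fillingE T (SeqSub cD)) (fillingE T (SeqSub cD')) row_le /= ?eqxx.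
  by rewrite (fillingE T (SeqSub cD)) (fillingE T (SeqSub cD')) col_lt /= ?eqxx.
apply/forallP => -[[i' j'] ijD'] /=; rewrite -!fillingE /=.
apply/andP; split; apply/implyP => /andP[/eqP eq_c lt_c]; subst.
  exact: row_le.
exact: col_lt.
Qed.

Definition entries_below k T := [forall y, T y < k].

Lemma entries_belowP k T : reflect {in D, forall c, filling T c < k} (entries_below k T).
Proof.
apply: (iffP forallP) => [below c cD|below y]; last by rewrite -fillingE below ?(valP y).
by rewrite -[c]/(val (SeqSub cD)) fillingE.
Qed.

Definition tableau_of (o : 'I_n) (g : nat * nat -> nat) : {ffun seq_sub D -> 'I_n} :=
  [ffun y => insubd o (g (val y))].

Lemma filling_tableau_of o g c : c \in D -> g c < n -> filling (tableau_of o g) c = g c.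
Proof.
by move=> cD lt_g; rewrite -[c]/(val (SeqSub cD)) fillingE ffunE val_insubd ifT.
Qed.

Local Open Scope ring_scope.

Definition var_at (i : nat) : {mpoly int[n]} :=
  if insub i is Some o then 'X_(o : 'I_n) else 0.

Lemma var_at_ord (o : 'I_n) : var_at o = 'X_o.
Proof. by rewrite /var_at valK. Qed.

Lemma tableau_monomialE T : uniq D ->
  \prod_y 'X_(T y) = \prod_(c <- D) var_at (filling T c) :> {mpoly int[n]}.
Proof.
move=> D_uniq; rewrite -(big_seq_sub _ (fun c => var_at (filling T c))) //.
by apply: eq_bigr => y _; rewrite fillingE var_at_ord.
Qed.

End Filling.

(** * The branching rule *)

Local Notation ferrers nu := (diagram nu [::]).

Lemma mem_ferrers nu i j : ((i.+1, j.+1) \in ferrers nu) = (j < nu`_i).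
Proof. by rewrite mem_diagram /part nth_nil. Qed.

Lemma ferrersP nu c :
  reflect (exists i j, c = (i.+1, j.+1) /\ j < nu`_i) (c \in ferrers nu).
Proof.
apply: (iffP idP) => [|[i [j [-> lt_j]]]]; last by rewrite mem_ferrers.
case: c => [] [|i] [|j]; rewrite mem_diagram ?andbF //= => lt_j.
by exists i, j; rewrite -mem_ferrers mem_diagram.
Qed.

Lemma size_ferrers nu : size (ferrers nu) = sumn nu.
Proof.
rewrite size_diagram; congr sumn.
apply: (@eq_from_nth _ 0); rewrite size_map size_iota // => i lt_i.
by rewrite (nth_map 0) ?size_iota // nth_iota // /part nth_nil subn0 add1n.
Qed.

Lemma eq_ferrers ka ka' : is_partition ka -> is_partition ka' ->
  ferrers ka =i ferrers ka' -> ka = ka'.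
Proof.
move=> ka_part ka'_part eq_ka; apply: eq_partition => // i.
have eq_row j : (j < ka`_i) = (j < ka'`_i) by rewrite -!mem_ferrers eq_ka.
by have := eq_row ka`_i; have := eq_row ka'`_i; rewrite !ltnn; lia.
Qed.

Lemma ferrers_sub nu ka c : hstrip nu ka -> c \in ferrers ka -> c \in ferrers nu.
Proof.
move=> strip /ferrersP[i [j [-> lt_j]]]; rewrite mem_ferrers.
exact: leq_trans lt_j (hstrip_le i strip).
Qed.

Section ShapeBelow.
Variables (n m : nat) (nu : seq nat).
Hypothesis nu_part : is_partition nu.
Implicit Types T : {ffun seq_sub (ferrers nu) -> 'I_n}.

Definition row_below T i := count (gtn m) [seq filling T (i.+1, j.+1) | j <- iota 0 nu`_i].

Definition shape_below T := partition_of (row_below T) (size nu).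

Lemma filling_ltn_row T i j :
  is_ssyt T -> j < nu`_i -> (filling T (i.+1, j.+1) < m) = (j < row_below T i).
Proof.
case/ssytP=> row_le _ lt_j; rewrite /row_below -sorted_nth_ltn ?size_map ?size_iota //.
  by rewrite (nth_map 0) ?size_iota // nth_iota.
apply/(sortedP 0) => k; rewrite size_map size_iota => lt_k.
rewrite !(nth_map 0) ?nth_iota ?size_iota ?(ltnW lt_k) // !add0n.
by apply: row_le; rewrite ?mem_ferrers ?(ltnW lt_k).
Qed.

Section BelowSucc.
Variable T : {ffun seq_sub (ferrers nu) -> 'I_n}.
Hypotheses (T_ssyt : is_ssyt T) (T_below : entries_below m.+1 T).

Let row_below_strip i : nu`_i.+1 <= row_below T i <= nu`_i.
Proof.
apply/andP; split; last first.
  by rewrite /row_below (leq_trans (count_size _ _)) ?size_map ?size_iota.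
case: (posnP nu`_i.+1) => [->|] //; case def_j: nu`_i.+1 => [|j] // _.
have lt_j : j < nu`_i.+1 by rewrite def_j.
have lt_j' : j < nu`_i := leq_trans lt_j (partition_nonincreasing nu_part i).
rewrite -filling_ltn_row //; have [_ col_lt] := ssytP _ T_ssyt.
apply: leq_trans (col_lt i.+1 i.+2 j.+1 _ _ _) _; rewrite ?mem_ferrers //.
by have /entries_belowP := T_below; apply; rewrite mem_ferrers.
Qed.

Let row_below_dec : nonincreasing (row_below T).
Proof. by move=> i; have := row_below_strip i; have := row_below_strip i.+1; lia. Qed.

Let row_below_size : row_below T (size nu) = 0.
Proof. by rewrite /row_below nth_default. Qed.

Lemma shape_below_is_partition : is_partition (shape_below T).
Proof. exact: partition_of_is_partition. Qed.

Lemma hstrip_shape_below : hstrip nu (shape_below T).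
Proof. by apply/hstripP => i; rewrite nth_partition_of. Qed.

Lemma filling_ltn_shape :
  {in ferrers nu, forall c, (filling T c < m) = (c \in ferrers (shape_below T))}.
Proof.
move=> c /ferrersP[i [j [-> lt_j]]].
by rewrite mem_ferrers nth_partition_of // filling_ltn_row.
Qed.

Lemma shape_below_unique ka : is_partition ka -> hstrip nu ka ->
  {in ferrers nu, forall c, (filling T c < m) = (c \in ferrers ka)} -> shape_below T = ka.
Proof.
move=> ka_part strip ltn_ka.
apply: eq_ferrers => // [|c]; first exact: shape_below_is_partition.
case: (boolP (c \in ferrers nu)) => [cD|cND]; first by rewrite -filling_ltn_shape // ltn_ka.
by rewrite !(contraNF (@ferrers_sub nu _ c _) cND) // hstrip_shape_below.
Qed.

End BelowSucc.
End ShapeBelow.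

Local Open Scope ring_scope.

Section RemoveLargest.
Variables (n m : nat) (nu ka : seq nat).
Hypotheses (nu_part : is_partition nu) (ka_part : is_partition ka) (strip : hstrip nu ka).
Hypothesis lt_mn : (m < n)%N.
Implicit Types (T : {ffun seq_sub (ferrers nu) -> 'I_n})
  (U : {ffun seq_sub (ferrers ka) -> 'I_n}).

Let m_ord : 'I_n := Ordinal lt_mn.

Let restrict T : {ffun seq_sub (ferrers ka) -> 'I_n} := tableau_of _ m_ord (filling T).

Let extend U : {ffun seq_sub (ferrers nu) -> 'I_n} :=
  tableau_of _ m_ord (fun c => if c \in ferrers ka then filling U c else m).

Let filling_restrict T c : c \in ferrers ka -> filling (restrict T) c = filling T c.
Proof. by move=> cE; rewrite filling_tableau_of ?filling_ltn ?(ferrers_sub strip). Qed.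

Let filling_extend U c :
  c \in ferrers nu -> filling (extend U) c = if c \in ferrers ka then filling U c else m.
Proof.
by move=> cD; rewrite filling_tableau_of //; case: ifP => // cE; rewrite filling_ltn.
Qed.

Let extendK : cancel extend restrict.
Proof.
move=> U; apply: eq_filling => c cE.
by rewrite filling_restrict // filling_extend ?cE // (ferrers_sub strip).
Qed.

Let restrictP T :
    [&& is_ssyt T, entries_below m.+1 T & shape_below m T == ka] ->
  [/\ is_ssyt (restrict T), entries_below m (restrict T) & extend (restrict T) = T].
Proof.
case/and3P=> T_ssyt T_below /eqP shapeT.
have ltn_ka c : c \in ferrers nu -> (filling T c < m)%N = (c \in ferrers ka).
  by rewrite -shapeT; apply: filling_ltn_shape.
have [row_le col_lt] := ssytP _ T_ssyt.
split.
- apply/ssytP; split=> [i j j'|i i' j] cE cE' lt_cc'; rewrite !filling_restrict //.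
    by apply: row_le; rewrite ?(ferrers_sub strip).
  by apply: col_lt; rewrite ?(ferrers_sub strip).
- apply/entries_belowP => c cE.
  by rewrite filling_restrict // ltn_ka // (ferrers_sub strip).
apply: eq_filling => c cD; rewrite filling_extend //.
case: ifPn => cE; first exact: filling_restrict.
have /entries_belowP/(_ c cD) := T_below; rewrite -ltn_ka // -leqNgt in cE.
by move=> le_m; apply/eqP; rewrite eqn_leq cE.
Qed.

Let extend_ssyt U : is_ssyt U -> entries_below m U -> is_ssyt (extend U).
Proof.
case/ssytP=> row_le col_lt /entries_belowP below.
apply/ssytP; split=> [i j j'|i i' j] cD cD' lt_cc'.
  rewrite !filling_extend //; case: ifPn => [cE|cE]; case: ifPn => [cE'|cE'] //.
  - exact: row_le.
  - by rewrite ltnW ?below.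
  case/negP: cE; move: cD cD' cE'; rewrite !mem_diagram; lia.
have cE : (i, j) \in ferrers ka.
  case/ferrersP: cD cD' lt_cc' => i0 [j0 [[-> ->] _]]; case: i' => // i1.
  rewrite !mem_ferrers ltnS => lt_j lt_i; apply: leq_trans lt_j _.
  exact: leq_trans (partition_nth_leq nu_part lt_i) (hstrip_ge i0 strip).
rewrite !filling_extend // cE; case: ifPn => [cE'|cE']; first exact: col_lt.
exact: below.
Qed.

Let extendP U : is_ssyt U && entries_below m U ->
  [&& is_ssyt (extend U), entries_below m.+1 (extend U) & shape_below m (extend U) == ka].
Proof.
case/andP=> U_ssyt U_below; have ext_ssyt := extend_ssyt U_ssyt U_below.
have /entries_belowP below := U_below.
have ext_below : entries_below m.+1 (extend U).
  apply/entries_belowP => c cD; rewrite filling_extend //.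
  by case: ifP => // cE; rewrite ltnW ?ltnS ?below.
rewrite ext_ssyt ext_below /=; apply/eqP; apply: shape_below_unique => // c cD.
by rewrite filling_extend //; case: ifP => [/below //|_]; rewrite ltnn.
Qed.

Let extend_monomial U :
  \prod_y 'X_(extend U y) = var_at n m ^+ (sumn nu - sumn ka) * \prod_y 'X_(U y)
    :> {mpoly int[n]}.
Proof.
have split_nu : perm_eq (ferrers nu)
    ([seq c <- ferrers nu | c \notin ferrers ka] ++ ferrers ka).
  apply: uniq_perm; rewrite ?cat_uniq ?filter_uniq ?diagram_uniq //= ?andbT.
    by apply/hasPn => c cE; rewrite mem_filter cE.
  move=> c; rewrite mem_cat mem_filter orbC; case: (boolP (c \in ferrers ka)) => //= cE.
  by rewrite (ferrers_sub strip).
rewrite !tableau_monomialE ?diagram_uniq // (perm_big _ split_nu) big_cat /=; congr (_ * _).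
  rewrite (eq_big_seq (fun=> var_at n m)) => [|c].
    rewrite big_const_seq count_predT iter_mulr_1; congr (_ ^+ _).
    by have := perm_size split_nu; rewrite size_cat !size_ferrers => ->; rewrite addnK.
  by rewrite mem_filter => /andP[cE cD]; rewrite filling_extend // (negbTE cE).
by apply: eq_big_seq => c cE; rewrite filling_extend ?cE // (ferrers_sub strip).
Qed.

Lemma sum_tableaux_shape_below :
  \sum_(T : {ffun seq_sub (ferrers nu) -> 'I_n} |
      [&& is_ssyt T, entries_below m.+1 T & shape_below m T == ka]) \prod_y 'X_(T y) =
  var_at n m ^+ (sumn nu - sumn ka) *
  \sum_(U : {ffun seq_sub (ferrers ka) -> 'I_n} | is_ssyt U && entries_below m U)
     \prod_y 'X_(U y)
  :> {mpoly int[n]}.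
Proof.
rewrite (reindex_onto extend restrict) /=; last by move=> T /restrictP[].
rewrite mulr_sumr; apply: eq_big => [U|U _]; last exact: extend_monomial.
apply/andP/idP => [[/restrictP[]]|UP]; last by rewrite extendP ?extendK.
by rewrite extendK => -> ->.
Qed.

End RemoveLargest.

Section BranchingRule.
Variable n : nat.

Let sum_tableaux_below0 nu : is_partition nu ->
  \sum_(T : {ffun seq_sub (ferrers nu) -> 'I_n} | is_ssyt T && entries_below 0 T)
     \prod_y 'X_(T y) = (nu == [::])%:R :> {mpoly int[n]}.
Proof.
move=> nu_part; case: (eqVneq nu [::]) => [->|nu_neq0] /=.
  have no_cell (y : seq_sub (ferrers [::])) : False by have := valP y.
  rewrite (big_pred1 [ffun y => False_rect _ (no_cell y)]) => [|T].
    by rewrite big1 // => y; case: (no_cell y).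
  have /= -> : T = [ffun y => False_rect _ (no_cell y)].
    by apply/ffunP => y; case: (no_cell y).
  rewrite eqxx; apply/andP.
  by split; [apply/ssytP | apply/forallP => y; case: (no_cell y)].
rewrite big_pred0 // => T; apply: contraTF isT => /andP[_ /entries_belowP/(_ (1, 1)%N)].
by rewrite mem_ferrers partition_nth_gt0 // lt0n size_eq0 => /(_ nu_neq0).
Qed.

Lemma sum_tableaux_below m nu : (m <= n)%N -> is_partition nu ->
  \sum_(T : {ffun seq_sub (ferrers nu) -> 'I_n} | is_ssyt T && entries_below m T)
     \prod_y 'X_(T y) = branching_schur (var_at n) m nu.
Proof.
elim: m nu => [|m IHm] nu le_mn nu_part; first exact: sum_tableaux_below0.
rewrite (@partition_big_seq _ _ _ _ _ (partitions_upto (sumn nu)) _ (hstrip nu)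
           (@shape_below n m nu)) /=.
- apply: eq_big_seq_cond => ka; rewrite mem_partitions_upto => /andP[ka_part _] strip.
  under eq_bigl => T do rewrite -andbA.
  by rewrite sum_tableaux_shape_below // IHm // ltnW.
- exact: partitions_upto_uniq.
move=> T /andP[T_ssyt T_below]; have strip := hstrip_shape_below nu_part T_ssyt T_below.
by rewrite strip andbT mem_partitions_upto hstrip_sumn // andbT shape_below_is_partition.
Qed.

Lemma schurE nu : is_partition nu -> schur n nu = branching_schur (var_at n) n nu.
Proof.
move=> nu_part; rewrite -sum_tableaux_below //; apply: eq_bigl => T.
by rewrite andb_idr // => _; apply/forallP.
Qed.

End BranchingRule.

Local Close Scope ring_scope.

(** * Words with prescribed adjacencies *)

Variant adjacency := Weak | Strict | Free.

Definition adjacent_ok (k : adjacency) (a b : nat) : bool :=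
  match k with Weak => b <= a | Strict => a < b | Free => true end.

Fixpoint respects (c : seq adjacency) (w : seq nat) : bool :=
  match c, w with
  | k :: c', a :: ((b :: _) as w') => adjacent_ok k a b && respects c' w'
  | _, _ => true
  end.

Lemma respects_weak m u : size u = m.+1 -> respects (nseq m Weak) u = sorted geq u.
Proof. by elim: m u => [|m IHm] [|a [|b u]] //= [size_u]; rewrite IHm /= ?size_u. Qed.

Lemma respects_cat m k c u v : size u = m.+1 -> 0 < size v ->
  respects (nseq m Weak ++ k :: c) (u ++ v) =
  [&& sorted geq u, adjacent_ok k (last 0 u) (head 0 v) & respects c v].
Proof.
elim: m u => [|m IHm] [|a [|b u]] //= size_u v_gt0; first by case: v v_gt0.
by rewrite (IHm (b :: u)) ?andbA //=; case: size_u => ->.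
Qed.

Local Open Scope ring_scope.

Section WordSums.
Variables (R : comNzRingType) (x : nat -> R) (n : nat).
Implicit Types c : seq adjacency.

Fixpoint word_sum_from c (a : nat) : R :=
  if c is k :: c' then x a * \sum_(b < n | adjacent_ok k a b) word_sum_from c' b else x a.

Definition word_sum c : R := \sum_(a < n) word_sum_from c a.

Let word_sum_from_free c1 c2 a : word_sum_from (c1 ++ Free :: c2) a =
  word_sum_from (c1 ++ Weak :: c2) a + word_sum_from (c1 ++ Strict :: c2) a.
Proof.
elim: c1 a => [|k c1 IHc] a /=.
  rewrite -mulrDr (bigID (fun b : 'I_n => (b <= a)%N)) /=; congr (_ * (_ + _)).
  by apply: eq_bigl => b; rewrite -ltnNge.
by rewrite -mulrDr -big_split; congr (_ * _); apply: eq_bigr => b _; apply: IHc.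
Qed.

Lemma word_sum_free c1 c2 :
  word_sum (c1 ++ Free :: c2) = word_sum (c1 ++ Weak :: c2) + word_sum (c1 ++ Strict :: c2).
Proof. by rewrite -big_split; apply: eq_bigr => a _; apply: word_sum_from_free. Qed.

Lemma word_sum_cat c1 c2 : word_sum (c1 ++ Free :: c2) = word_sum c1 * word_sum c2.
Proof.
rewrite /word_sum mulr_suml; apply: eq_bigr => a _.
elim: c1 (a : nat) => [|k c1 IHc] {}a //=.
by rewrite -mulrA mulr_suml; congr (_ * _); apply: eq_bigr => b _; apply: IHc.
Qed.

Lemma word_sum_weak m : word_sum (nseq m Weak) = complete_homogeneous x n m.+1.
Proof.
rewrite -sum_complete_homogeneous; apply: eq_bigr => a _; have := ltn_ord a.
elim: m (a : nat) => [|m IHm] {}a lt_a; first by rewrite complete_homogeneous0 mulr1.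
rewrite [LHS]/= -sum_complete_homogeneous; congr (_ * _).
rewrite (big_ord_widen_cond n predT (fun b => x b * complete_homogeneous x b.+1 m)) //.
by apply: eq_bigr => b _; apply: IHm.
Qed.

Let word_sum_from_tuple c a : word_sum_from c a =
  \sum_(t : (size c).-tuple 'I_n | respects c (a :: map val t))
     x a * \prod_(i <- t) x (val i).
Proof.
elim: c a => [|k c IHc] a /=.
  rewrite (big_pred1 [tuple]) => [|t]; first by rewrite big_nil mulr1.
  by rewrite [t]tuple0 /= eqxx.
rewrite big_tuple_cons mulr_sumr big_mkcond /=; apply: eq_bigr => b _.
case: ifP => [ok_ab|_]; last by rewrite big_pred0.
by rewrite IHc mulr_sumr /=; apply: eq_bigr => t _; rewrite big_cons.
Qed.

Lemma word_sum_tuple c : word_sum c =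
  \sum_(t : (size c).+1.-tuple 'I_n | respects c (map val t)) \prod_(i <- t) x (val i).
Proof.
rewrite big_tuple_cons; apply: eq_bigr => a _; rewrite word_sum_from_tuple.
by apply: eq_bigr => t _; rewrite /= big_cons.
Qed.

End WordSums.

Section Reading.
Variables (n : nat) (D E : seq (nat * nat)).
Hypotheses (E_uniq : uniq E) (eqDE : D =i E).

Let cell_in_D (k : 'I_(size E)) : tnth (in_tuple E) k \in D.
Proof. by rewrite eqDE mem_tnth. Qed.

Let cell_at k : seq_sub D := SeqSub (cell_in_D k).

Let index_in_E (y : seq_sub D) : (index (val y) E < size E)%N.
Proof. by rewrite index_mem -eqDE (valP y). Qed.

Let position y : 'I_(size E) := Ordinal (index_in_E y).

Let cell_atK : cancel cell_at position.
Proof. by move=> k; apply: val_inj; rewrite /= (tnth_nth (0, 0)%N) index_uniq. Qed.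

Let positionK : cancel position cell_at.
Proof.
by move=> y; apply: val_inj; rewrite /= (tnth_nth (0, 0)%N) nth_index // -eqDE (valP y).
Qed.

Let word_of (T : {ffun seq_sub D -> 'I_n}) : (size E).-tuple 'I_n :=
  [tuple T (cell_at k) | k < size E].

Let filling_of (t : (size E).-tuple 'I_n) : {ffun seq_sub D -> 'I_n} :=
  [ffun y => tnth t (position y)].

Let map_word_of T : map val (word_of T) = [seq filling T c | c <- E].
Proof.
rewrite -[E in RHS]/(tval (in_tuple E)) -(map_tnth_enum (in_tuple E)) -!map_comp.
by apply: eq_map => k; exact: esym (fillingE T (cell_at k)).
Qed.

Lemma sum_fillings_words (P : pred {ffun seq_sub D -> 'I_n}) (Q : pred (seq nat)) :
    (forall T, P T = Q [seq filling T c | c <- E]) ->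
  \sum_(T | P T) \prod_y 'X_(T y) =
  \sum_(t : (size E).-tuple 'I_n | Q (map val t)) \prod_(i <- t) var_at n (val i)
    :> {mpoly int[n]}.
Proof.
move=> PQ; rewrite [RHS](reindex word_of); last first.
  exists filling_of => [T _|t _].
    by apply/ffunP => y; rewrite ffunE tnth_mktuple positionK.
  by apply: eq_from_tnth => k; rewrite tnth_mktuple ffunE cell_atK.
apply: eq_big => [T|T _]; first by rewrite PQ map_word_of.
rewrite (@big_tuple _ _ _ _ _ (word_of T)) (reindex cell_at) /=.
  by apply: eq_bigr => k _; rewrite tnth_mktuple var_at_ord.
by exists position => y _; [apply: cell_atK | apply: positionK].
Qed.

End Reading.

Local Close Scope ring_scope.

(** * Ribbon tableaux as words *)

(* [(a, b) :: L] stands for a row of length [a] followed by the rows [L]; [b] tells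
   whether this row overlaps the next one. *)
Definition ribbon_data := seq (nat * bool).

Implicit Type L : ribbon_data.

Definition row_lengths L := unzip1 L.

Definition link_adjacency (overlap : bool) := if overlap then Strict else Free.

Fixpoint row_adjacencies L : seq adjacency :=
  if L is (a, b) :: L' then
    nseq a.-1 Weak ++ (if L' is [::] then [::] else link_adjacency b :: row_adjacencies L')
  else [::].

Lemma row_adjacencies_cons a b L : 0 < size L ->
  row_adjacencies ((a, b) :: L) = nseq a.-1 Weak ++ link_adjacency b :: row_adjacencies L.
Proof. by case: L. Qed.

Lemma size_row_adjacencies L : all (leq 1) (row_lengths L) -> 0 < size L ->
  (size (row_adjacencies L)).+1 = sumn (row_lengths L).
Proof.
elim: L => // -[a b] L IHL /andP[/= a_gt0 L_gt0] _; rewrite size_cat size_nseq.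
case: L IHL L_gt0 => [_ _|row L IHL L_gt0]; first by rewrite /= addn0; lia.
by rewrite -IHL //= addnS; lia.
Qed.

Definition ribbon_word_sum (R : comNzRingType) (x : nat -> R) n L : R :=
  if L is [::] then 1%R else word_sum x n (row_adjacencies L).

(* The last condition excludes the 2x2 squares. *)
Definition long_row_ribbon (lam mu : seq nat) : Prop :=
  [/\ is_partition lam, is_partition mu,
      forall i, 1 <= i <= size lam -> part mu i + 2 <= part lam i &
      forall i, 1 <= i -> part lam i.+1 <= (part mu i).+1].

Lemma part_leq s i j : is_partition s -> 0 < i -> i <= j -> part s j <= part s i.
Proof. by move=> s_part i_gt0 le_ij; apply: partition_nth_leq; lia. Qed.

Lemma part_oversize s i : size s < i -> part s i = 0.
Proof. by move=> lt_i; rewrite /part nth_default //; lia. Qed.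

Section RowReading.
Variables lam mu : seq nat.

Definition overlaps_next i : bool := part mu i < part lam i.+1.

Definition row_reading r : seq (nat * nat) :=
  [seq (r, j) | j <- rev (iota (part mu r).+1 (part lam r - part mu r))].

Definition rows_reading i k : seq (nat * nat) :=
  flatten [seq row_reading r | r <- iota i k].

Definition rows_data i k : ribbon_data :=
  [seq (part lam r - part mu r, overlaps_next r) | r <- iota i k].

Lemma mem_row_reading r c :
  (c \in row_reading r) = (c.1 == r) && (part mu r < c.2 <= part lam r).
Proof.
case: c => i j; apply/mapP/andP => /= [[j']|[/eqP -> jP]].
  by rewrite mem_rev mem_iota => j'P [-> ->]; rewrite eqxx; split=> //; lia.
by exists j => //; rewrite mem_rev mem_iota; lia.
Qed.

Lemma mem_rows_reading i k c :
  (c \in rows_reading i k) = (i <= c.1 < i + k) && (part mu c.1 < c.2 <= part lam c.1).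
Proof.
apply/flatten_mapP/andP => [[r]|[c1P c2P]].
  by rewrite mem_iota mem_row_reading => rP /andP[/eqP -> cP].
by exists c.1; rewrite ?mem_iota ?mem_row_reading ?eqxx.
Qed.

Lemma rows_reading_uniq i k : uniq (rows_reading i k).
Proof.
elim: k i => // k IHk i.
rewrite /rows_reading /= cat_uniq -/(rows_reading i.+1 k) IHk andbT.
rewrite map_inj_uniq ?rev_uniq ?iota_uniq => [|j j' []] //=.
apply/hasPn => c; rewrite mem_rows_reading mem_row_reading; lia.
Qed.

Lemma size_row_reading r : size (row_reading r) = part lam r - part mu r.
Proof. by rewrite size_map size_rev size_iota. Qed.

Lemma last_row_reading g r : part mu r < part lam r ->
  last 0 (map g (row_reading r)) = g (r, (part mu r).+1).
Proof.
rewrite -subn_gt0 /row_reading; case: (part lam r - part mu r) => // d _.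
by rewrite /= rev_cons !map_rcons last_rcons.
Qed.

Lemma head_row_reading g r w : part mu r < part lam r ->
  head 0 (map g (row_reading r) ++ w) = g (r, part lam r).
Proof.
move=> lt_r; have size_r : part lam r - part mu r = (part lam r - part mu r).-1 + 1 by lia.
by rewrite /row_reading size_r iotaD rev_cat /=; congr (g (r, _)); lia.
Qed.

Lemma sorted_row_readingP g r : reflect
  (forall j j', part mu r < j -> j < j' -> j' <= part lam r -> g (r, j) <= g (r, j'))
  (sorted geq (map g (row_reading r))).
Proof.
rewrite /row_reading -map_comp map_rev rev_sorted; set s := map _ _.
have size_s : size s = part lam r - part mu r by rewrite size_map size_iota.
have nth_s k : k < size s -> s`_k = g (r, (part mu r).+1 + k).
  by rewrite size_s => lt_k; rewrite (nth_map 0) ?size_iota // nth_iota.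
apply: (iffP idP) => [s_sorted j j' lt_j lt_jj' le_j'|g_le].
  have := @sorted_ltn_nth _ leq leq_trans 0 s s_sorted (j - (part mu r).+1)
    (j' - (part mu r).+1).
  by rewrite !inE !nth_s ?subnKC ?size_s; try lia; apply; lia.
by apply/(sortedP 0) => k lt_k; rewrite !nth_s ?(ltnW lt_k) //; apply: g_le; lia.
Qed.

End RowReading.

Definition ribbon_rows (lam mu : seq nat) : ribbon_data := rows_data lam mu 1 (size lam).

Definition ribbon_reading (lam mu : seq nat) : seq (nat * nat) :=
  rows_reading lam mu 1 (size lam).

Lemma diagram_ribbon_reading lam mu : diagram lam mu =i ribbon_reading lam mu.
Proof.
move=> [i j]; rewrite mem_diagram mem_rows_reading /= add1n ltnS.
by case: (leqP i (size lam)) => [|/part_oversize ->]; lia.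
Qed.

Lemma size_ribbon_reading lam mu :
  size (ribbon_reading lam mu) = sumn (row_lengths (ribbon_rows lam mu)).
Proof.
rewrite size_flatten /shape /row_lengths /unzip1 -!map_comp; congr sumn.
by apply: eq_map => r; rewrite /= size_row_reading.
Qed.

Section RibbonReading.
Variables lam mu : seq nat.
Hypothesis ribbon : long_row_ribbon lam mu.

Let lam_part : is_partition lam. Proof. by case: ribbon. Qed.
Let mu_part : is_partition mu. Proof. by case: ribbon. Qed.
Let row_ge2 i : 1 <= i <= size lam -> part mu i + 2 <= part lam i.
Proof. by case: ribbon => _ _ + _; apply. Qed.
Let next_row_le i : 1 <= i -> part lam i.+1 <= (part mu i).+1.
Proof. by case: ribbon => _ _ _; apply. Qed.

Lemma respects_rows_reading g i k : 1 <= i -> i + k <= (size lam).+1 ->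
  respects (row_adjacencies (rows_data lam mu i k)) (map g (rows_reading lam mu i k)) =
  all (fun r => sorted geq (map g (row_reading lam mu r))) (iota i k) &&
  all (fun r => overlaps_next lam mu r ==>
                (g (r, (part mu r).+1) < g (r.+1, part lam r.+1))) (iota i k.-1).
Proof.
elim: k i => [|[|k] IHk] i i_gt0 le_ik //; have row_i := @row_ge2 i ltac:(lia).
  rewrite [row_adjacencies _]/= /rows_reading /= !cats0 !andbT respects_weak //.
  by rewrite size_map size_row_reading; lia.
have row_i1 := @row_ge2 i.+1 ltac:(lia).
have size_i : size (map g (row_reading lam mu i)) = (part lam i - part mu i).-1.+1.
  by rewrite size_map size_row_reading; lia.
rewrite -[rows_data lam mu _ _]/((_, overlaps_next lam mu i) :: rows_data lam mu i.+1 k.+1)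
  row_adjacencies_cons //.
rewrite -[rows_reading lam mu _ _]/(row_reading lam mu i ++ rows_reading lam mu i.+1 k.+1)
  map_cat respects_cat //; last first.
  by rewrite size_map /rows_reading /= size_cat size_row_reading; lia.
have head_reading :
    head 0 (map g (rows_reading lam mu i.+1 k.+1)) = g (i.+1, part lam i.+1).
  by rewrite /rows_reading /= map_cat head_row_reading //; lia.
rewrite last_row_reading ?head_reading ?IHk //; try lia.
by rewrite andbA [RHS]andbACA; congr (_ && _ && _); case: overlaps_next.
Qed.

Lemma ribbon_column_pair i i' j : i < i' ->
  (i, j) \in diagram lam mu -> (i', j) \in diagram lam mu ->
  [/\ i' = i.+1, j = (part mu i).+1 & j = part lam i.+1].
Proof.
rewrite !mem_diagram => lt_i /andP[i_gt0 ijD] /andP[_ i'jD].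
have := @next_row_le i i_gt0; have := @part_leq lam i.+1 i' lam_part isT lt_i.
case: (eqVneq i' i.+1) => [i'E *|ne_i']; first by subst i'; split; lia.
have le_i' : i' <= size lam.
  by rewrite leqNgt; apply/negP => /part_oversize lam0; move: i'jD; rewrite lam0; lia.
have := @next_row_le i.+1 isT; have := @part_leq lam i.+2 i' lam_part isT.
by have := @row_ge2 i.+1; lia.
Qed.

Lemma ssyt_respects n (T : {ffun seq_sub (diagram lam mu) -> 'I_n}) :
  is_ssyt T =
  respects (row_adjacencies (ribbon_rows lam mu))
    [seq filling T c | c <- ribbon_reading lam mu].
Proof.
rewrite respects_rows_reading //;
  apply/ssytP/andP => [[row_le col_lt]|[/allP rows /allP overlaps]].
  split; apply/allP => r; rewrite mem_iota => rP.
    by apply/sorted_row_readingP => j j' *; apply: row_le; rewrite ?mem_diagram; lia.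
  apply/implyP => overlap_r; have := @next_row_le r; have := @row_ge2 r.
  have := @row_ge2 r.+1.
  rewrite /overlaps_next in overlap_r => *; have -> : part lam r.+1 = (part mu r).+1 by lia.
  by apply: col_lt; rewrite ?mem_diagram; lia.
have row_le_size i j : (i, j) \in diagram lam mu -> 1 <= i <= size lam.
  by rewrite diagram_ribbon_reading mem_rows_reading /=; lia.
split=> [i j j' ijD ij'D lt_j|i i' j ijD i'jD lt_i].
  have /rows/sorted_row_readingP : i \in iota 1 (size lam).
    by rewrite mem_iota; have := row_le_size _ _ ijD; lia.
  by apply=> //; move: ijD ij'D; rewrite !mem_diagram; lia.
have [i'E jE jE'] := ribbon_column_pair lt_i ijD i'jD; subst i'.
have /overlaps : i \in iota 1 (size lam).-1.
  by rewrite mem_iota; have := row_le_size _ _ ijD; have := row_le_size _ _ i'jD; lia.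
by rewrite -jE -jE' /overlaps_next -jE' jE leqnn.
Qed.

Lemma row_lengths_ribbon_rows_gt0 : all (leq 1) (row_lengths (ribbon_rows lam mu)).
Proof.
apply/allP => _ /mapP[_ /mapP[r + ->] ->]; rewrite mem_iota /= => rP.
by have := @row_ge2 r; lia.
Qed.

Lemma skew_schur_ribbon n :
  skew_schur n lam mu = ribbon_word_sum (var_at n) n (ribbon_rows lam mu).
Proof.
rewrite /skew_schur.
rewrite (sum_fillings_words (rows_reading_uniq _ _ _ _) (@diagram_ribbon_reading lam mu)
           (@ssyt_respects n)).
case: (posnP (size lam)) => [size0|size_gt0].
  rewrite /ribbon_rows /ribbon_reading size0 /= (big_pred1 [tuple]) ?big_nil // => t.
  by rewrite [t]tuple0; apply/esym/eqP.
have data_gt0 : 0 < size (ribbon_rows lam mu) by rewrite size_map size_iota.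
rewrite size_ribbon_reading -size_row_adjacencies ?row_lengths_ribbon_rows_gt0 //
  -word_sum_tuple.
by case: (ribbon_rows lam mu) data_gt0.
Qed.

End RibbonReading.

(** * Merging consecutive strips *)

Lemma sumn_ltn_row nu ka : sumn ka < sumn nu -> exists i, ka`_i < nu`_i.
Proof.
pose K := size nu + size ka.
rewrite -(@sum_nth_sumn ka K) ?leq_addl // -(@sum_nth_sumn nu K) ?leq_addr //.
by case/sum_ord_lt_exists => i _; exists i.
Qed.

Definition merging (ka nu rho : seq nat) : bool :=
  [&& hstrip rho nu, hstrip nu ka & ~~ strip_descent ka nu rho].

Lemma merging_hstrip ka nu rho : merging ka nu rho -> hstrip rho ka.
Proof.
case/and3P=> /hstripP rho_nu /hstripP nu_ka no_descent; apply/hstripP => i.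
have := rho_nu i; have := nu_ka i; have := rho_nu i.+1.
have := nu_ka i.+1.
by case: (ltnP ka`_i nu`_i) => [/(strip_descentPn no_descent (leqnn i.+1))|]; lia.
Qed.

Lemma strip_descent_merge_inner ka nu rho tau : merging ka nu rho -> sumn nu < sumn rho ->
  strip_descent nu rho tau = strip_descent ka rho tau.
Proof.
case/and3P=> /hstripP rho_nu /hstripP nu_ka no_descent lt_nu.
apply/strip_descentP/strip_descentP => -[i [j [lt_ij lt_i lt_j]]].
  by exists i, j; split=> //; have := nu_ka i; lia.
have [k lt_k] := sumn_ltn_row lt_nu.
case: (ltnP nu`_i rho`_i) => [lt_nui|ge_nui]; first by exists i, j.
exists k, j; split=> //; apply: leq_ltn_trans lt_ij; rewrite leqNgt; apply/negP => lt_ik.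
by have := strip_descentPn no_descent lt_ik; lia.
Qed.

Lemma strip_descent_merge_outer xi ka nu rho : merging ka nu rho -> sumn ka < sumn nu ->
  strip_descent xi ka nu = strip_descent xi ka rho.
Proof.
case/and3P=> /hstripP rho_nu /hstripP nu_ka no_descent lt_ka.
apply/strip_descentP/strip_descentP => -[i [j [lt_ij lt_i lt_j]]].
  by exists i, j; split=> //; have := rho_nu j; lia.
have [k lt_k] := sumn_ltn_row lt_ka.
case: (ltnP ka`_j nu`_j) => [lt_kaj|ge_kaj]; first by exists i, j.
exists i, k; split=> //; apply: leq_trans lt_ij _; rewrite leqNgt; apply/negP => lt_kj.
by have := strip_descentPn no_descent lt_kj lt_k; lia.
Qed.

Section MergeCount.
Variables (rho ka : seq nat) (a a' : nat).
Hypothesis size_rho : sumn rho = sumn ka + a' + a.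

Let room i := rho`_i - ka`_i.

Let merging_prefix nu k : sumn nu = sumn ka + a' -> merging ka nu rho ->
  \sum_(i < k) (rho`_i - nu`_i) = minn a (\sum_(i < k) room i).
Proof.
move=> size_nu /and3P[/hstripP rho_nu /hstripP nu_ka no_descent].
pose removed i := rho`_i - nu`_i; pose K := k + size rho + size nu.
have removed_total : \sum_(i < K) removed i = a.
  rewrite sumnB => [|i _]; last by case/andP: (rho_nu i).
  by rewrite !sum_nth_sumn ?size_rho ?size_nu /K; lia.
have le_a : \sum_(i < k) removed i <= a.
  by rewrite -removed_total leq_sum_ord_widen // /K; lia.
have le_room : \sum_(i < k) removed i <= \sum_(i < k) room i.
  by apply: leq_sum => i _; rewrite /removed /room; have := nu_ka i; lia.
rewrite -[LHS]/(\sum_(i < k) removed i).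
apply/eqP; rewrite eqn_leq leq_min le_a le_room geq_min /=; apply/orP.
case: (boolP [exists i : 'I_k, ka`_i < nu`_i]) => [/existsP[i lt_i]|/existsPn full].
  left; rewrite -removed_total (@eq_sum_ord_widen removed k K) /K //; first by lia.
  move=> j le_kj; have := strip_descentPn no_descent (leq_trans (ltn_ord i) le_kj) lt_i.
  by rewrite /removed; lia.
right; apply: leq_sum => i _; have := full i; have := nu_ka i.
by rewrite /removed /room; lia.
Qed.

Let merging_unique nu nu' : is_partition nu -> is_partition nu' ->
  sumn nu = sumn ka + a' -> sumn nu' = sumn ka + a' ->
  merging ka nu rho -> merging ka nu' rho -> nu = nu'.
Proof.
move=> nu_part nu'_part size_nu size_nu' nu_merges nu'_merges; apply: eq_partition => // i.
have eq_prefix k : \sum_(j < k) (rho`_j - nu`_j) = \sum_(j < k) (rho`_j - nu'`_j).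
  by rewrite (merging_prefix k size_nu nu_merges) (merging_prefix k size_nu' nu'_merges).
have := eq_prefix i.+1; rewrite !big_ord_recr /= eq_prefix => /addnI.
have [/and3P[rho_nu _ _] /and3P[rho_nu' _ _]] := (nu_merges, nu'_merges).
by have := hstrip_le i rho_nu; have := hstrip_le i rho_nu'; lia.
Qed.

Let greedy_rows i := rho`_i - greedy_fill room a i.

Let merging_exists : hstrip rho ka ->
  exists nu, [/\ is_partition nu, sumn nu = sumn ka + a' & merging ka nu rho].
Proof.
move/hstripP=> strip; pose K := size rho + size ka.
have fill_le i : greedy_fill room a i <= room i by apply: geq_minl.
have roomE i : room i + ka`_i = rho`_i by rewrite /room; have := strip i; lia.
have rows_bounds i : rho`_i.+1 <= greedy_rows i /\ ka`_i <= greedy_rows i <= rho`_i.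
  by rewrite /greedy_rows; have := fill_le i; have := strip i; have := roomE i; lia.
have rows_dec : nonincreasing greedy_rows.
  by move=> i; have := rows_bounds i; have := rows_bounds i.+1; lia.
have rows0 : greedy_rows K = 0 by rewrite /greedy_rows nth_default // leq_addr.
exists (partition_of greedy_rows K); split; first exact: partition_of_is_partition.
  have sum_rows : \sum_(i < K) greedy_rows i + \sum_(i < K) greedy_fill room a i = sumn rho.
    rewrite -big_split -(@sum_nth_sumn rho K) ?leq_addr //.
    apply: eq_bigr => i _; rewrite /greedy_rows /=.
    by have := fill_le i; have := roomE i; lia.
  have sum_room : \sum_(i < K) room i + sumn ka = sumn rho.
    rewrite -(@sum_nth_sumn rho K) ?leq_addr // -(@sum_nth_sumn ka K) ?leq_addl //
      -big_split.
    by apply: eq_bigr => i _; apply: roomE.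
  by rewrite sumn_partition_of //; move: sum_rows; rewrite sum_greedy_fill; lia.
apply/and3P; split.
- by apply/hstripP => i; rewrite nth_partition_of //; have := rows_bounds i; lia.
- by apply/hstripP => i; rewrite !nth_partition_of //; have := strip i;
    have := rows_bounds i; have := rows_bounds i.+1; lia.
apply/strip_descentP => -[i [j [lt_ij]]].
rewrite !nth_partition_of // /greedy_rows => lt_i lt_j.
have fill_j : 0 < greedy_fill room a j by lia.
by have := greedy_fill_full lt_ij fill_j; have := roomE i; lia.
Qed.

Lemma merging_count :
  count (fun nu => merging ka nu rho) (partitions (sumn ka + a')) = hstrip rho ka.
Proof.
case: (boolP (hstrip rho ka)) => [strip|not_strip]; last first.
  rewrite (eq_count (a2 := pred0)) ?count_pred0 // => nu.
  by apply: contraNF not_strip; apply: merging_hstrip.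
have [nu0 [nu0_part size_nu0 nu0_merges]] := merging_exists strip.
rewrite (eq_in_count (a2 := pred1 nu0)); last first.
  move=> nu; rewrite mem_partitions => /andP[nu_part /eqP size_nu].
  by apply/idP/eqP => [nu_merges|-> //]; apply: merging_unique.
by rewrite count_uniq_mem ?partitions_uniq // mem_partitions nu0_part size_nu0 eqxx.
Qed.

End MergeCount.

(** * Chains of horizontal strips *)

(* The chains of strips below [nu] whose sizes and descents are prescribed by [L];
   [rho / nu] is the strip removed before, and [descent] requires a descent between
   it and the next strip. *)
Fixpoint chain_count L (descent : bool) (rho nu : seq nat) : nat :=
  if L is (a, b) :: L' then
    \sum_(ka <- partitions (sumn nu - a)
        | [&& a <= sumn nu, hstrip nu ka & descent ==> strip_descent ka nu rho])
      chain_count L' b nu ka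
  else nu == [::].

Lemma chain_count_cons a b L d rho nu s : sumn nu = s + a ->
  chain_count ((a, b) :: L) d rho nu =
  \sum_(ka <- partitions s | hstrip nu ka && (d ==> strip_descent ka nu rho))
     chain_count L b nu ka.
Proof. by move=> /= ->; rewrite addnK leq_addl. Qed.

Lemma chain_count_sumn L d rho nu :
  is_partition nu -> 0 < chain_count L d rho nu -> sumn nu = sumn (row_lengths L).
Proof.
elim: L d rho nu => [|[a b] L IHL] d rho nu nu_part /=; first by case: eqP => // ->.
rewrite lt0n sum_nat_seq_neq0 => /hasP[ka].
rewrite mem_partitions => /andP[ka_part /eqP size_ka].
by case/andP=> /and3P[le_a _ _]; rewrite -lt0n => /(IHL _ _ _ ka_part); lia.
Qed.

Lemma chain_count_no_descent L rho nu :
  chain_count L false rho nu = chain_count L false [::] nu.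
Proof. by case: L => [|[]]. Qed.

Lemma chain_count_merging L b ka nu rho : merging ka nu rho -> sumn ka < sumn nu ->
  chain_count L b nu ka = chain_count L b rho ka.
Proof.
case: L => [|[a c] L] // merges lt_ka; apply: eq_bigl => xi.
by rewrite (strip_descent_merge_outer xi merges lt_ka).
Qed.

Lemma sum_chain_count_merging a a' b L d tau rho s : 0 < a -> 0 < a' -> is_partition rho ->
    sumn rho = s + a' + a ->
  \sum_(nu <- partitions (s + a') | hstrip rho nu && (d ==> strip_descent nu rho tau))
     \sum_(ka <- partitions s | hstrip nu ka && ~~ strip_descent ka nu rho)
       chain_count L b nu ka
  = chain_count ((a + a', b) :: L) d tau rho.
Proof.
move=> a_gt0 a'_gt0 rho_part size_rho.
transitivity (\sum_(nu <- partitions (s + a')) \sum_(ka <- partitions s | merging ka nu rho)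
    if d ==> strip_descent ka rho tau then chain_count L b rho ka else 0).
  rewrite big_mkcond; apply: eq_big_seq => nu.
  rewrite mem_partitions => /andP[nu_part /eqP size_nu].
  case: (boolP (hstrip rho nu)) => [strip|/negbTE not_strip]; last first.
    by rewrite /= big_pred0 // => ka; rewrite /merging not_strip.
  transitivity (\sum_(ka <- partitions s | merging ka nu rho)
      if d ==> strip_descent nu rho tau then chain_count L b nu ka else 0).
    by rewrite /merging strip /=; case: ifP => // _; rewrite big1.
  apply: eq_big_seq_cond => ka.
  rewrite mem_partitions => /andP[ka_part /eqP size_ka] merges.
  rewrite (strip_descent_merge_inner _ merges) ?(chain_count_merging _ _ merges) //; lia.
rewrite (@chain_count_cons _ _ _ _ _ _ s); last by lia.
rewrite (exchange_big_dep predT) //= [RHS]big_mkcondr big_mkcond; apply: eq_big_seq => ka.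
rewrite mem_partitions => /andP[ka_part /eqP size_ka].
rewrite big_const_seq iter_addn_0 -size_ka.
rewrite (merging_count (a := a)) ?size_ka //.
by case: (hstrip rho ka); rewrite ?muln1 ?muln0.
Qed.

Lemma chain_count_merge a a' b L d tau rho : 0 < a -> 0 < a' -> is_partition rho ->
  chain_count ((a, false) :: (a', b) :: L) d tau rho =
  chain_count ((a + a', b) :: L) d tau rho +
  chain_count ((a, true) :: (a', b) :: L) d tau rho.
Proof.
move=> a_gt0 a'_gt0 rho_part.
have [size_rho|size_neq] := eqVneq (sumn rho) (sumn (row_lengths L) + a' + a); last first.
  have no_chain M : sumn (row_lengths M) = sumn (row_lengths L) + a' + a ->
    chain_count M d tau rho = 0.
    move=> size_M; apply/eqP; rewrite -leqn0 leqNgt; apply: contra size_neq.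
    by move/(chain_count_sumn rho_part) ->; rewrite size_M.
  by rewrite !no_chain //= /row_lengths; lia.
rewrite -(sum_chain_count_merging _ _ _ _ a_gt0 a'_gt0 rho_part size_rho).
rewrite !(chain_count_cons _ _ _ _ size_rho) -big_split; apply: eq_big_seq_cond => nu.
rewrite mem_partitions => /andP[_ /eqP size_nu] _.
rewrite !(chain_count_cons _ _ _ _ size_nu).
rewrite (bigID (fun ka => ~~ strip_descent ka nu rho)) /=.
by congr (_ + _); apply: eq_bigl => ka; rewrite andbT ?negbK.
Qed.

Lemma chain_count_merge_cat L1 a a' b L d rho nu : 0 < a -> 0 < a' -> is_partition nu ->
  chain_count (L1 ++ (a, false) :: (a', b) :: L) d rho nu =
  chain_count (L1 ++ (a + a', b) :: L) d rho nu +
  chain_count (L1 ++ (a, true) :: (a', b) :: L) d rho nu.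
Proof.
move=> a_gt0 a'_gt0.
elim: L1 d rho nu => [|[c e] L1 IHL] d rho nu nu_part; first exact: chain_count_merge.
rewrite [LHS]/= [in RHS]/= -big_split /=; apply: eq_big_seq_cond => ka.
by rewrite mem_partitions => /andP[ka_part _] _; apply: IHL.
Qed.

(** * The Schur expansion of a ribbon *)

Lemma row_adjacencies_split L1 a a' b L : 0 < a -> 0 < a' -> exists c1 c2,
  (forall b0,
     row_adjacencies (L1 ++ (a, b0) :: (a', b) :: L) = c1 ++ link_adjacency b0 :: c2) /\
  row_adjacencies (L1 ++ (a + a', b) :: L) = c1 ++ Weak :: c2.
Proof.
move=> a_gt0 a'_gt0; elim: L1 => [|[c e] L1 [c1 [c2 [links weak]]]].
  exists (nseq a.-1 Weak), (row_adjacencies ((a', b) :: L)); split=> //=.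
  have -> : (a + a').-1 = a.-1 + a'.-1.+1 by lia.
  by rewrite nseqD -catA.
exists (nseq c.-1 Weak ++ link_adjacency e :: c1), c2.
by split=> [b0|];
  rewrite cat_cons row_adjacencies_cons ?size_cat ?addnS // ?links ?weak -catA.
Qed.

Local Open Scope ring_scope.

Section Expansion.
Variables (R : comNzRingType) (x : nat -> R) (n : nat).

Lemma ribbon_word_sum_merge L1 a a' b L : (0 < a)%N -> (0 < a')%N ->
  ribbon_word_sum x n (L1 ++ (a, false) :: (a', b) :: L) =
  ribbon_word_sum x n (L1 ++ ((a + a')%N, b) :: L) +
  ribbon_word_sum x n (L1 ++ (a, true) :: (a', b) :: L).
Proof.
move=> a_gt0 a'_gt0; have [c1 [c2 [links weak]]] :=
  row_adjacencies_split L1 b L a_gt0 a'_gt0.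
have sumE M : (0 < size M)%N -> ribbon_word_sum x n M = word_sum x n (row_adjacencies M)
  by case: M.
by rewrite !sumE ?size_cat ?addnS // !links weak word_sum_free.
Qed.

Lemma ribbon_word_sum_cons_free a L : (0 < a)%N ->
  ribbon_word_sum x n ((a, false) :: L) =
  complete_homogeneous x n a * ribbon_word_sum x n L.
Proof.
move=> a_gt0; case: L => [|row L]; first by rewrite /= cats0 word_sum_weak prednK ?mulr1.
by rewrite [LHS]/= word_sum_cat word_sum_weak prednK.
Qed.

Definition chain_expansion L : R :=
  \sum_(nu <- partitions (sumn (row_lengths L)))
     (chain_count L false [::] nu)%:R * branching_schur x n nu.

Lemma chain_expansion_merge L1 a a' b L : (0 < a)%N -> (0 < a')%N ->
  chain_expansion (L1 ++ (a, false) :: (a', b) :: L) =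
  chain_expansion (L1 ++ ((a + a')%N, b) :: L) +
  chain_expansion (L1 ++ (a, true) :: (a', b) :: L).
Proof.
move=> a_gt0 a'_gt0.
rewrite /chain_expansion /row_lengths /unzip1 !map_cat !sumn_cat /= !addnA.
rewrite -big_split; apply: eq_big_seq => nu; rewrite mem_partitions => /andP[nu_part _] /=.
by rewrite chain_count_merge_cat // natrD mulrDl.
Qed.

Lemma chain_expansion_cons_free a L :
  chain_expansion ((a, false) :: L) = complete_homogeneous x n a * chain_expansion L.
Proof.
set m := sumn (row_lengths L).
have size_cons : sumn (row_lengths ((a, false) :: L)) = (m + a)%N by rewrite addnC.
rewrite /chain_expansion mulr_sumr size_cons.
transitivity (\sum_(ka <- partitions m) \sum_(nu <- partitions (m + a) | hstrip nu ka)
    (chain_count L false [::] ka)%:R * branching_schur x n nu); last first.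
  apply: eq_big_seq => ka; rewrite mem_partitions => /andP[ka_part /eqP size_ka].
  by rewrite mulrCA pieri // size_ka mulr_sumr.
rewrite [RHS](exchange_big_dep predT) //; apply: eq_big_seq => nu.
rewrite mem_partitions => /andP[nu_part /eqP size_nu].
rewrite (chain_count_cons _ _ _ _ size_nu) natr_sum mulr_suml.
by apply: eq_big => ka; rewrite ?andbT // => _; rewrite chain_count_no_descent.
Qed.

Lemma ribbon_word_sum_free L : all (leq 1) (row_lengths L) -> ~~ has snd L ->
  ribbon_word_sum x n L = chain_expansion L.
Proof.
elim: L => [|[a b] L IHL] /=.
  rewrite /chain_expansion (perm_big _ perm_partitions0) big_seq1.
  by rewrite branching_schur_nil mulr1.
case/andP=> a_gt0 L_gt0; rewrite negb_or => /andP[/negbTE -> L_free].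
by rewrite -/(ribbon_word_sum x n ((a, false) :: L)) ribbon_word_sum_cons_free //
  chain_expansion_cons_free IHL.
Qed.

Lemma ribbon_word_sumE L : all (leq 1) (row_lengths L) -> ~~ (last (0%N, false) L).2 ->
  ribbon_word_sum x n L = chain_expansion L.
Proof.
have [k] := ubnP (count snd L); elim: k L => // k IHk L lt_k L_gt0 L_last.
have [has_overlap|] := boolP (has snd L); last exact: ribbon_word_sum_free.
move: lt_k L_gt0 L_last; case/split_find: has_overlap => -[a []] // L1 L2 _ _.
rewrite cat_rcons.
case: L2 => [|[a' b] L2]; first by rewrite last_cat.
rewrite /row_lengths /unzip1 map_cat all_cat last_cat count_cat /=.
move=> lt_k /and4P[L1_gt0 a_gt0 a'_gt0 L2_gt0] L_last.
apply: (@addrI _ (ribbon_word_sum x n (L1 ++ ((a + a')%N, b) :: L2))).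
rewrite -ribbon_word_sum_merge // !IHk ?chain_expansion_merge //.
- by rewrite count_cat /=; lia.
- by rewrite /row_lengths /unzip1 map_cat all_cat /= L1_gt0 addn_gt0 a_gt0.
- by rewrite last_cat /=; case: (L2) L_last.
- by rewrite count_cat /=; lia.
- by rewrite /row_lengths /unzip1 map_cat all_cat /= L1_gt0 a_gt0 a'_gt0.
by rewrite last_cat.
Qed.

End Expansion.

Local Close Scope ring_scope.

(** * Linear independence of Schur polynomials *)

Lemma count_ferrers_row nu i : count (fun c => c.1.-1 == i) (ferrers nu) = nu`_i.
Proof.
rewrite -size_filter -[RHS](size_iota 1) -[RHS](size_map (pair i.+1)).
apply/perm_size/uniq_perm; rewrite ?filter_uniq ?diagram_uniq ?map_inj_uniq ?iota_uniq //;
  first by move=> j j' [].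
move=> c; rewrite mem_filter; apply/andP/mapP =>
  [[/eqP <- /ferrersP[i' [j [-> lt_j]]]]|[j]].
  by exists j.+1 => //; rewrite mem_iota.
by case: j => [|j]; rewrite mem_iota // ltnS => lt_j ->; rewrite mem_ferrers.
Qed.

Section Content.
Variables (n : nat) (nu : seq nat).
Hypothesis nu_part : is_partition nu.
Implicit Types T : {ffun seq_sub (ferrers nu) -> 'I_n}.

Definition content T : 'X_{1..n} := (\sum_y U_(T y))%MM.

Definition multinom_of (ka : seq nat) : 'X_{1..n} := [multinom ka`_i | i < n].

Lemma contentE T i : content T i = count (fun c => filling T c == i) (ferrers nu).
Proof.
rewrite mnm_sumE -sum1_count [RHS]big_mkcond -[RHS]big_seq_sub ?diagram_uniq //.
by apply: eq_bigr => y _; rewrite mnmE fillingE -val_eqE; case: eqP.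
Qed.

Lemma mcoeff_schur m :
  ((schur n nu)@_m =
   (\sum_(T : {ffun seq_sub (ferrers nu) -> 'I_n} | is_ssyt T) (content T == m))%:R)%R.
Proof.
rewrite /schur /skew_schur raddf_sum natr_sum /=; apply: eq_bigr => T _.
by rewrite mprodXE mcoeffX.
Qed.

Lemma ssyt_row_le_entry T : is_ssyt T -> {in ferrers nu, forall c, c.1.-1 <= filling T c}.
Proof.
case/ssytP=> _ col_lt _ /ferrersP[i [j [-> lt_j]]] /=; elim: i lt_j => // i IHi lt_j.
have lt_j' : j < nu`_i := leq_trans lt_j (partition_nonincreasing nu_part i).
by apply: leq_ltn_trans (IHi lt_j') (col_lt _ _ _ _ _ _); rewrite ?mem_ferrers.
Qed.

Lemma mcoeff_schur_prefix ka j : size ka <= n -> ((schur n nu)@_(multinom_of ka) != 0)%R ->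
  \sum_(i < j) ka`_i <= \sum_(i < j) nu`_i.
Proof.
move=> size_ka; rewrite mcoeff_schur pnatr_eq0 sum_nat_eq0 negb_forall => /existsP[T].
rewrite negb_imply eqb0 negbK => /andP[T_ssyt /eqP contentT].
have kaE i : ka`_i = count (fun c => filling T c == i) (ferrers nu).
  case: (ltnP i n) => [lt_i|le_n].
    by rewrite -[i]/(val (Ordinal lt_i)) -contentE contentT mnmE.
  rewrite nth_default ?(leq_trans size_ka) //.
  rewrite (eq_in_count (a2 := pred0)) ?count_pred0 // => c cD.
  by rewrite ltn_eqF // (leq_trans (filling_ltn T cD)).
under eq_bigr do rewrite kaE; under [leqRHS]eq_bigr do rewrite -count_ferrers_row.
rewrite !sum_count_fibers -!size_filter; apply: uniq_leq_size;
  rewrite ?filter_uniq ?diagram_uniq // => c.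
rewrite !mem_filter => /andP[lt_j cD]; rewrite cD andbT.
exact: leq_ltn_trans (ssyt_row_le_entry T_ssyt cD) lt_j.
Qed.

(* The tableau whose entries are its row indices contributes. *)
Lemma mcoeff_schur_self : size nu <= n -> ((schur n nu)@_(multinom_of nu) != 0)%R.
Proof.
move=> size_nu; have row_lt (y : seq_sub (ferrers nu)) : (val y).1.-1 < n.
  have /ferrersP[i [j [-> lt_j]]] := valP y; apply: leq_trans size_nu.
  by rewrite -partition_nth_gt0 // (leq_ltn_trans _ lt_j).
pose T := [ffun y => Ordinal (row_lt y)].
have fillT c : c \in ferrers nu -> filling T c = c.1.-1.
  by move=> cD; rewrite -[c]/(val (SeqSub cD)) fillingE ffunE.
have T_ssyt : is_ssyt T.
  apply/ssytP; split=> [i j j'|i i' j] cD cD' lt_cc'; rewrite !fillT //=.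
  by case/ferrersP: cD => i0 [j0 [[-> _] _]] in lt_cc' *; case: i' lt_cc' {cD'}.
rewrite mcoeff_schur pnatr_eq0 sum_nat_eq0 negb_forall; apply/existsP; exists T.
rewrite negb_imply T_ssyt eqb0 negbK; apply/eqP/mnmP => i; rewrite contentE mnmE.
by rewrite -count_ferrers_row; apply: eq_in_count => c /fillT ->.
Qed.

End Content.

Definition dominance_height k (nu : seq nat) := \sum_(j < k.+1) \sum_(i < j) nu`_i.

Lemma dominance_height_le k nu : sumn nu = k -> dominance_height k nu <= k.+1 * k.
Proof.
move=> size_nu; apply: (@sum_ord_le_const (fun j => \sum_(i < j) nu`_i)) => j _.
by rewrite -size_nu leq_sum_nth_sumn.
Qed.

Lemma dominance_height_ltn k ka nu : is_partition ka -> is_partition nu -> sumn ka = k ->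
  dominated ka nu -> ka != nu -> dominance_height k ka < dominance_height k nu.
Proof.
move=> ka_part nu_part size_ka /dominatedP[eq_size dom] ne_ka; rewrite ltnNge.
apply: contra ne_ka => height_ge.
apply/eqP/(dominated_anti ka_part nu_part) => //; apply/dominatedP; split=> // k'.
case: (leqP k' k) => [le_k'|lt_k']; last first.
  by rewrite !sum_nth_sumn ?eq_size // (leq_trans (size_partition_le _)) // -?eq_size
    size_ka ltnW.
rewrite leqNgt; apply/negP => lt_k'; move: height_ge; apply/negP; rewrite -ltnNge.
have lt_k'S : k' < k.+1 by [].
rewrite /dominance_height (bigD1 (Ordinal lt_k'S)) //= [ltnRHS](bigD1 (Ordinal lt_k'S)) //=.
by rewrite -addSn leq_add // leq_sum // => j _; apply: dom.
Qed.

Local Open Scope ring_scope.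

Lemma schur_independent n k (d : seq nat -> int) : (k <= n)%N ->
    \sum_(nu <- partitions k) d nu *: schur n nu = 0 ->
  {in partitions k, forall nu, d nu = 0}.
Proof.
move=> le_kn sum0 ka; have [m] := ubnP (k.+1 * k - dominance_height k ka)%N.
elim: m ka => // m IHm ka lt_m ka_in; have := ka_in.
rewrite mem_partitions => /andP[ka_part /eqP size_ka].
have size_ka_n : (size ka <= n)%N
  by rewrite (leq_trans (size_partition_le ka_part)) ?size_ka.
have := congr1 (mcoeff (multinom_of n ka)) sum0; rewrite mcoeff0 raddf_sum /=.
rewrite (bigD1_seq ka) ?partitions_uniq //= big1_seq => [|nu]; last first.
  case/andP=> ne_nu nu_in; have := nu_in.
  rewrite mem_partitions => /andP[nu_part /eqP size_nu].
  rewrite mcoeffZ.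
  have [->|coef_neq0] := eqVneq ((schur n nu)@_(multinom_of n ka)) 0; first exact: mulr0.
  have dom : dominated ka nu.
    apply/dominatedP; split=> [|j]; first by rewrite size_ka size_nu.
    exact: mcoeff_schur_prefix coef_neq0.
  have lt_height : (dominance_height k ka < dominance_height k nu)%N.
    by apply: dominance_height_ltn; rewrite // eq_sym.
  by rewrite IHm ?mul0r //; have := dominance_height_le size_nu; lia.
rewrite addr0 mcoeffZ => /eqP; rewrite mulf_eq0 => /orP[/eqP // | ].
by rewrite (negbTE (mcoeff_schur_self ka_part size_ka_n)).
Qed.

Local Close Scope ring_scope.

(** * Removing one horizontal strip *)

Definition cells_from L i := sumn (drop i (row_lengths L)).

Definition overlaps_from L i := count snd (drop i L).

Definition admissible L (nu : seq nat) : Prop :=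
  [/\ is_partition nu, dominated (row_lengths L) nu &
      forall i, nu`_i + overlaps_from L i <= cells_from L i].

Definition long_decreasing_rows L : bool :=
  [&& sorted geq (row_lengths L), all (leq 2) (row_lengths L) & ~~ (last (0, false) L).2].

Lemma long_decreasing_rows_cons a b L : long_decreasing_rows ((a, b) :: L) ->
  long_decreasing_rows L.
Proof.
case/and3P=> /path_sorted L_sorted /andP[_ L_ge2] L_last; apply/and3P; split=> //.
by case: L L_last {L_sorted L_ge2}.
Qed.

Lemma overlaps_from_le L i : long_decreasing_rows L -> overlaps_from L i <= size L - i.+1.
Proof.
case/and3P=> _ _; case/lastP: L => [|L row];
  rewrite // last_rcons size_rcons subSS => /negbTE row_free.
rewrite /overlaps_from.
case: (leqP i (size L)) => [le_i|lt_i]; last by rewrite drop_oversize ?size_rcons.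
by rewrite drop_rcons // -cats1 count_cat /= row_free !addn0 -size_drop count_size.
Qed.

Lemma overlaps_fromS L i :
  overlaps_from L i = (nth (0, false) L i).2 + overlaps_from L i.+1.
Proof.
rewrite /overlaps_from; case: (ltnP i (size L)) => [lt_i|le_i].
  by rewrite (drop_nth (0, false)).
by rewrite nth_default // !drop_oversize // ltnW.
Qed.

Lemma overlaps_from_dec L : nonincreasing (overlaps_from L).
Proof. by move=> i; rewrite [leqRHS]overlaps_fromS leq_addl. Qed.

Lemma cells_from_ge L i : long_decreasing_rows L -> 2 * (size L - i) <= cells_from L i.
Proof. by case/and3P=> _ L_ge2 _; rewrite -(size_map fst); apply: sumn_drop_ge. Qed.

Lemma cells_fromS L i : cells_from L i = (row_lengths L)`_i + cells_from L i.+1.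
Proof. exact: sumn_drop_nth. Qed.

Lemma sum_row_lengths L k :
  \sum_(j < k) (row_lengths L)`_j + cells_from L k = cells_from L 0.
Proof. by rewrite /cells_from drop0 sum_nth_sumn_drop. Qed.

Lemma last_max_exists (f : nat -> nat) K : nonincreasing f -> f K < f 0 ->
  exists2 m, f m = f 0 & f m.+1 < f 0.
Proof.
move=> f_dec lt_K; have [[|m] lt_m min_m] :=
  ex_minnP (ex_intro (fun k => f k < f 0) K lt_K).
  by rewrite ltnn in lt_m.
exists m => //; apply/eqP; rewrite eqn_leq nonincreasing_leq //= leqNgt.
by apply/negP => /min_m; rewrite ltnn.
Qed.

Section NextStrip.
Variables (a : nat) (b : bool) (L : ribbon_data) (nu : seq nat).
Hypotheses (data_long : long_decreasing_rows ((a, b) :: L))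
  (nu_adm : admissible ((a, b) :: L) nu).

Let alpha := row_lengths ((a, b) :: L).
Let l := size L.

Let L_long : long_decreasing_rows L := long_decreasing_rows_cons data_long.
Let nu_part : is_partition nu. Proof. by case: nu_adm. Qed.
Let nu_dec : nonincreasing (nth 0 nu) := partition_nonincreasing nu_part.
Let nu_anti i j : i <= j -> nu`_j <= nu`_i. Proof. exact: partition_nth_leq. Qed.

Let a_ge2 : 2 <= a. Proof. by case/and3P: data_long => _ /andP[]. Qed.

Let alpha_le_a k : alpha`_k <= a.
Proof.
case/and3P: data_long => alpha_sorted _ _; case: k => // k.
have geq_trans : transitive geq by move=> x y z xy yz; apply: leq_trans yz xy.
have /(all_nthP 0)/(_ k) := order_path_min geq_trans alpha_sorted.
by case: (ltnP k (size (row_lengths L))) => [_ /(_ isT)|?] //; rewrite /= nth_default.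
Qed.

Let nu_sum : sumn nu = a + cells_from L 0.
Proof. by have [_ [<- _] _] := nu_adm; rewrite /cells_from drop0. Qed.

Let nu_dom k : \sum_(j < k) alpha`_j <= \sum_(j < k) nu`_j.
Proof. by have [_ /dominatedP[]] := nu_adm. Qed.

Let nu0_le : nu`_0 + b + overlaps_from L 0 <= a + cells_from L 0.
Proof. by have [_ _ /(_ 0)] := nu_adm; rewrite addnA /overlaps_from /cells_from !drop0. Qed.

Let nuS_le i : nu`_i.+1 + overlaps_from L i <= cells_from L i.
Proof. by have [_ _ /(_ i.+1)] := nu_adm. Qed.

Let nu_gt_size i : l < i -> nu`_i = 0.
Proof.
case: i => // i lt_i; apply/eqP; rewrite -leqn0.
apply: leq_trans (leq_addr _ _) (leq_trans (nuS_le i) _).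
by rewrite /cells_from drop_oversize // size_map.
Qed.

Let nu0_ge : a <= nu`_0. Proof. by have := nu_dom 1; rewrite !big_ord1. Qed.

Let sum_alphaS k : \sum_(j < k.+1) alpha`_j = a + \sum_(j < k) (row_lengths L)`_j.
Proof. exact: sum_ord_recl. Qed.

(* The largest possible length of row [i] once the first row of the ribbon is removed. *)
Let cap i := cells_from L i - overlaps_from L i.

Let overlaps_le i : overlaps_from L i <= l - i.+1. Proof. exact: overlaps_from_le. Qed.

Let cells_ge i : 2 * (l - i) <= cells_from L i. Proof. exact: cells_from_ge. Qed.

Let capE i : cap i + overlaps_from L i = cells_from L i.
Proof. by rewrite subnK //; have := overlaps_le i; have := cells_ge i; lia. Qed.

Let cap_ge i : i < l -> l - i < cap i.
Proof. by have := overlaps_le i; have := cells_ge i; have := capE i; lia. Qed.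

Let nuS_le_cap i : nu`_i.+1 <= cap i.
Proof. by have := nuS_le i; have := capE i; lia. Qed.

Let nu_le_cap i : nu`_i <= alpha`_i + cap i.
Proof.
case: i => [|i]; first by have := nu0_le; have := capE 0; rewrite /=; lia.
have := nuS_le i; have := capE i.+1; have := overlaps_from_dec L i; have := cells_fromS L i.
by rewrite -[alpha`_i.+1]/((row_lengths L)`_i); lia.
Qed.

Section LastMaxRow.
Variable m : nat.
Hypotheses (nu_m : nu`_m = nu`_0) (nu_mS : nu`_m.+1 < nu`_0).

(* [m] is the last longest row. Keeping the next partition below [shrunk] makes the
   removed strip reach the last column, so that the next strip that leaves the first
   row is a descent. *)
Let shrunk j := nu`_j - (j == m).

Let bound j := minn (shrunk j) (cap j).

Let sum_shrunk k : \sum_(j < k) shrunk j + (m < k) = \sum_(j < k) nu`_j.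
Proof.
elim: k => [|k IHk]; first by rewrite !big_ord0.
rewrite !sum_ord_recr -IHk ltnS leq_eqVlt /shrunk.
by case: (eqVneq m k) => [<-|_] /=; rewrite ?nu_m ?ltnn; lia.
Qed.

Let sum_shrunk_ge k : \sum_(j < k) (row_lengths L)`_j <= \sum_(j < k) shrunk j.
Proof.
have shift_alpha := sum_alphaS k; rewrite sum_ord_recr in shift_alpha.
have := sum_shrunk k; have := nu_dom k; have := alpha_le_a k.
case: (ltnP m k) => [lt_mk|_] alpha_k dom_k sum_k; last by lia.
rewrite leqNgt; apply/negP => lt_sum.
have alpha_k_max : alpha`_k = a by lia.
have nu_k : a <= nu`_k by have := nu_dom k.+1; rewrite !sum_ord_recr; lia.
have nu_k_lt : nu`_k < nu`_0 by apply: leq_ltn_trans nu_mS; apply: nu_anti.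
have sum_alpha_le : \sum_(j < k) alpha`_j <= k * a.
  by apply: (@sum_ord_le_const (nth 0 alpha)) => j _; apply: alpha_le_a.
have := sum_nonincreasing_ge k nu_dec; have := leq_mul (leqnn k) nu_k.
by rewrite sum_ord_recr; lia.
Qed.

Let bound_gt0 j : j < l -> 0 < nu`_j -> 0 < bound j.
Proof.
move=> lt_j nu_j; rewrite leq_min /shrunk (leq_trans _ (cap_ge lt_j)) // andbT.
by case: eqP => [->|_]; rewrite ?nu_m /=; lia.
Qed.

Let sum_bound_gap i k : i < k <= l -> 0 < nu`_k.-1 ->
  \sum_(j < i.+1) bound j + (k - i.+1) <= \sum_(j < k) bound j.
Proof.
move=> lt_ik nu_k; apply: sum_ord_ge_size => [|j lt_j]; first by lia.
by apply: bound_gt0; [lia | apply: leq_trans nu_k (nu_anti _); lia].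
Qed.

(* The bound [cap i] is so close to the number of all remaining cells that little is
   needed from the rows after the first row that it cuts. *)
Let sum_bound_cut i k : i < k <= l -> cap i < shrunk i ->
    (forall j, j < i -> shrunk j <= cap j) ->
    0 < nu`_k.-1 \/ (exists2 i', i < i' < k & cap i' < shrunk i') ->
  \sum_(j < k) (row_lengths L)`_j <= \sum_(j < k) bound j.
Proof.
move=> lt_ik cut_i first_i tail.
have sum_head : cells_from L 0 <= \sum_(j < i.+1) bound j + overlaps_from L i.
  have -> : \sum_(j < i.+1) bound j = \sum_(j < i) shrunk j + cap i.
    rewrite sum_ord_recr; congr (_ + _); last by rewrite /bound; lia.
    by apply: eq_bigr => j _; have := first_i j (ltn_ord j); rewrite /bound; lia.
  by have := sum_shrunk_ge i; have := capE i; have := sum_row_lengths L i; lia.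
suff : \sum_(j < i.+1) bound j + overlaps_from L i <= \sum_(j < k) bound j + cells_from L k.
  by have := sum_row_lengths L k; lia.
have overlaps_i := overlaps_le i; case: tail => [nu_k|[i' lt_ii' cut_i']].
  by have := sum_bound_gap lt_ik nu_k; have := cells_ge k; lia.
have nu_i' : 0 < nu`_i'.-1.
  by apply: leq_trans (nu_anti (leq_pred i')); rewrite /shrunk in cut_i'; lia.
have lt_i'k : i' < k by case/andP: lt_ii'.
have := @sum_bound_gap i i' ltac:(lia) nu_i'; have := @cap_ge i' ltac:(lia).
by have := leq_sum_ord_widen bound lt_i'k; rewrite sum_ord_recr {2}/bound; lia.
Qed.

Let shrunk_lt_cap i : i < l -> cap i < shrunk i -> shrunk i < a + cap i.
Proof.
move=> lt_i cut_i; have nu_i := nu_le_cap i; have alpha_i := alpha_le_a i.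
case: (ltngtP i m) => [lt_im|lt_mi|eq_im]; last by subst i; rewrite /shrunk eqxx; lia.
  have : nu`_m <= nu`_i.+1 by apply: nu_anti.
  by have := nuS_le_cap i; have := nu_anti (leq0n i); rewrite nu_m /shrunk in cut_i *; lia.
have shrunk_i : shrunk i = nu`_i by rewrite /shrunk gtn_eqF // subn0.
rewrite shrunk_i ltnNge; apply/negP => ge_nu.
have nu_iE : nu`_i = a + cap i by lia.
have nu_i_lt : nu`_i < nu`_0 by apply: leq_ltn_trans nu_mS; apply: nu_anti.
have sum_nu : \sum_(j < i.+1) nu`_j <= a + cells_from L 0
  by rewrite -nu_sum leq_sum_nth_sumn.
have sum_alpha_le : \sum_(j < i.+1) alpha`_j <= i.+1 * a.
  by apply: (@sum_ord_le_const (nth 0 alpha)) => j _; apply: alpha_le_a.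
have cap_i_le : cap i <= i * cap i by rewrite leq_pmull //; lia.
have := sum_nonincreasing_ge i nu_dec; have := sum_alphaS i; have := sum_row_lengths L i.
have := cap_ge lt_i; have := overlaps_le i; have := capE i.
by rewrite nu_iE mulnDr; rewrite mulSn in sum_alpha_le; lia.
Qed.

Let sum_bound_single_cut i k : i < k <= l -> cap i < shrunk i ->
    (forall j, j < k -> j != i -> shrunk j <= cap j) -> nu`_k.-1 = 0 ->
  \sum_(j < k) (row_lengths L)`_j <= \sum_(j < k) bound j.
Proof.
move=> lt_ik cut_i single nu_k; have lt_ik' : i < k by lia.
have nu_vanishes j : k.-1 <= j -> nu`_j = 0.
  by move=> le_kj; apply: (nonincreasing_eq0 nu_dec le_kj).
have lt_mk : m < k by rewrite ltnNge; apply/negP => le_km; have := nu_vanishes m; lia.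
have sum_nu : \sum_(j < k) nu`_j = a + cells_from L 0.
  rewrite -nu_sum; apply: sum_nth_sumn; rewrite leqNgt -partition_nth_gt0 // nu_vanishes //.
  exact: leq_pred.
have sum_bound : \sum_(j < k) bound j + shrunk i = \sum_(j < k) shrunk j + cap i.
  rewrite (bigD1 (Ordinal lt_ik')) //= [in RHS](bigD1 (Ordinal lt_ik')) //=.
  rewrite (eq_bigr (fun j : 'I_k => shrunk j)) => [|j ne_j].
    by rewrite {1}/bound; lia.
  by have := single j (ltn_ord j) ne_j; rewrite /bound; lia.
have := sum_shrunk k; have := shrunk_lt_cap (_ : i < l) cut_i; have := sum_row_lengths L k.
by rewrite lt_mk sum_nu => + /(_ ltac:(lia)); lia.
Qed.

Let sum_bound_ge k : k <= l -> \sum_(j < k) (row_lengths L)`_j <= \sum_(j < k) bound j.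
Proof.
move=> le_kl; case: (boolP [exists j : 'I_k, cap j < shrunk j]) =>
  [/existsP cuts|/existsPn no_cut].
  have exists_cut : exists i, (i < k) && (cap i < shrunk i).
    by case: cuts => j cut_j; exists j; rewrite ltn_ord.
  have [i /andP[lt_ik cut_i] min_i] := ex_minnP exists_cut.
  have first_i j : j < i -> shrunk j <= cap j.
    move=> lt_ji; rewrite leqNgt; apply/negP => cut_j.
    by have := min_i j; rewrite cut_j (ltn_trans lt_ji lt_ik) leqNgt lt_ji => /(_ isT).
  have lt_ikl : i < k <= l by rewrite lt_ik.
  case: (posnP nu`_k.-1) => [nu_k|nu_k]; last first.
    by apply: sum_bound_cut first_i _ => //; left.
  case: (boolP [exists j : 'I_k, (i < j) && (cap j < shrunk j)]) =>
    [/existsP[j /andP[lt_ij cut_j]]|].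
    by apply: sum_bound_cut first_i _ => //; right; exists j; rewrite ?lt_ij ?ltn_ord.
  move/existsPn=> no_other; apply: (sum_bound_single_cut lt_ikl) => // j lt_jk.
  rewrite neq_ltn => /orP[/first_i //|lt_ij].
  by have := no_other (Ordinal lt_jk); rewrite lt_ij /= -leqNgt.
apply: leq_trans (sum_shrunk_ge k) _; apply: leq_sum => j _.
by rewrite leq_min leqnn leqNgt no_cut.
Qed.

Let nuS_le_bound j : nu`_j.+1 <= bound j.
Proof.
rewrite leq_min nuS_le_cap andbT /shrunk; case: eqP => [->|_]; last by rewrite subn0.
by rewrite nu_m; lia.
Qed.

(* The most dominant partition between the shifted [nu] and [bound]. *)
Let next_row j := nu`_j.+1 + greedy_fill (fun i => bound i - nu`_i.+1) (nu`_0 - a) j.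

Let next_row_le j : nu`_j.+1 <= next_row j <= bound j.
Proof. by have := nuS_le_bound j; rewrite /next_row /greedy_fill; lia. Qed.

Let bound_le j : bound j <= nu`_j /\ bound j <= cap j.
Proof. by rewrite /bound /shrunk; lia. Qed.

Let sum_next_row k :
  \sum_(j < k) next_row j + a =
  minn (\sum_(j < k) bound j + a) (\sum_(j < k.+1) nu`_j).
Proof.
have sum_bound : \sum_(j < k) bound j =
    \sum_(j < k) nu`_j.+1 + \sum_(j < k) (bound j - nu`_j.+1).
  by rewrite -big_split; apply: eq_bigr => j _; rewrite /= subnKC.
have := nu0_ge; rewrite big_split sum_greedy_fill sum_bound.
by rewrite (sum_ord_recl (nth 0 nu)) /=; lia.
Qed.

Let next_row_dec : nonincreasing next_row.
Proof.
by move=> j; have := next_row_le j; have := next_row_le j.+1; have := bound_le j.+1; lia.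
Qed.

Let next_row_size : next_row l = 0.
Proof.
have := next_row_le l; have := bound_le l.
by rewrite /cap /cells_from drop_oversize ?size_map //=; lia.
Qed.

Let next := partition_of next_row l.

Let nth_next i : next`_i = next_row i. Proof. exact: nth_partition_of. Qed.

Let sumn_next : sumn next = cells_from L 0.
Proof.
rewrite sumn_partition_of //; have := sum_next_row l; have := sum_bound_ge (leqnn l).
have : \sum_(j < l.+1) nu`_j = a + cells_from L 0.
  by rewrite -nu_sum; apply: sum_nth_sumn; rewrite leqNgt -partition_nth_gt0 // nu_gt_size.
have := sum_row_lengths L l; rewrite {1}/cells_from drop_oversize ?size_map //=; lia.
Qed.

Let next_dom : dominated (row_lengths L) next.
Proof.
apply/dominatedP; split=> [|k]; first by rewrite sumn_next /cells_from drop0.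
have [le_kl|lt_lk] := leqP k l; last first.
  by rewrite [leqRHS]sum_nth_sumn ?sumn_next ?/cells_from ?drop0 ?leq_sum_nth_sumn //
     (leq_trans (size_partition_of _ _)) // ltnW.
have -> : \sum_(j < k) next`_j = \sum_(j < k) next_row j.
  by apply: eq_bigr => j _; apply: nth_next.
have := sum_next_row k; have := sum_bound_ge le_kl; have := nu_dom k.+1.
rewrite sum_alphaS; lia.
Qed.

Let next_admissible : admissible L next.
Proof.
split=> [||i]; [exact: partition_of_is_partition | exact: next_dom |].
rewrite nth_next; have := next_row_le i; have := bound_le i; have := capE i; lia.
Qed.

Let next_hstrip : hstrip nu next.
Proof.
by apply/hstripP => i; rewrite nth_next; have := next_row_le i; have := bound_le i; lia.
Qed.

(* Otherwise the strip is the single row of [a] cells at the end of the first row, and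
   this contradicts the bound on that row. *)
Let next_descent : b -> exists2 j, 0 < j & next`_j < nu`_j.
Proof.
move=> b_true; have := nu0_le; rewrite b_true => nu0_lt.
have [/existsP[j /andP[j_gt0 lt_j]]|/existsPn no_descent] :=
    boolP [exists j : 'I_l.+1, (0 < j) && (next`_j < nu`_j)]; first by exists j.
have rows_kept j : 0 < j <= l -> next_row j = nu`_j.
  case/andP=> j_gt0 le_jl; have := no_descent (Ordinal (le_jl : j < l.+1)).
  by rewrite j_gt0 /= nth_next; have := next_row_le j; have := bound_le j; lia.
have tail_kept : \sum_(j < l) next_row j.+1 = \sum_(j < l) nu`_j.+1.
  by apply: eq_bigr => j _; rewrite rows_kept //= ltn_ord.
have sum_nu : nu`_0 + \sum_(j < l) nu`_j.+1 = a + cells_from L 0.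
  rewrite -sum_ord_recl -nu_sum; apply: sum_nth_sumn.
  by rewrite leqNgt -partition_nth_gt0 // nu_gt_size.
have sum_next : next_row 0 + \sum_(j < l) next_row j.+1 = cells_from L 0.
  rewrite -sum_ord_recl sum_ord_recr next_row_size addn0 -sumn_next.
  by rewrite sumn_partition_of.
have next0 : next_row 0 + a = nu`_0 by lia.
have nu1_gt0 : 0 < nu`_1.
  rewrite lt0n; apply/eqP => nu1; have : \sum_(j < l) nu`_j.+1 = 0; last by lia.
  by apply: big1 => j _; apply: (nonincreasing_eq0 nu_dec _ nu1).
have := sum_next_row 1; have := capE 0; rewrite !sum_ord_recr !big_ord0 /bound /shrunk; lia.
Qed.

Let next_last_max : next`_m < nu`_m.
Proof.
by rewrite nth_next; have := next_row_le m; rewrite /bound /shrunk eqxx nu_m; lia.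
Qed.

Lemma next_strip_at : exists ka, [/\ admissible L ka, hstrip nu ka, ka`_m < nu`_m &
  b -> exists2 j, 0 < j & ka`_j < nu`_j].
Proof. by exists next. Qed.

End LastMaxRow.

Lemma next_strip : exists m ka,
  [/\ admissible L ka, hstrip nu ka, nu`_m = nu`_0, ka`_m < nu`_m &
  b -> exists2 j, 0 < j & ka`_j < nu`_j].
Proof.
have lt_max : nu`_l.+1 < nu`_0 by rewrite nu_gt_size //; lia.
have [m nu_m nu_mS] := last_max_exists nu_dec lt_max.
by have [ka [ka_adm strip ka_m ka_descent]] := next_strip_at nu_m nu_mS; exists m, ka.
Qed.

End NextStrip.

(** * Existence of chains *)

Lemma chain_count_consP a b L (d : bool) rho nu :
  reflect (exists ka, [/\ is_partition ka, sumn nu = sumn ka + a, hstrip nu ka,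
                          d -> strip_descent ka nu rho & 0 < chain_count L b nu ka])
          (0 < chain_count ((a, b) :: L) d rho nu).
Proof.
rewrite [chain_count _ _ _ _]/= lt0n sum_nat_seq_neq0.
apply: (iffP hasP) => [[ka]|[ka [ka_part size_nu strip descent chain]]].
  rewrite mem_partitions => /andP[ka_part /eqP size_ka]
    /andP[/and3P[le_a strip /implyP descent] chain].
  by exists ka; rewrite lt0n size_ka subnK.
exists ka; first by rewrite mem_partitions ka_part size_nu addnK eqxx.
by rewrite size_nu leq_addl strip (introT implyP descent) -lt0n.
Qed.

(* A descent below a strip puts one of the cells of that strip outside the first row. *)
Lemma chain_count_admissible L (d : bool) rho nu :
    ~~ (last (0, false) L).2 -> is_partition nu -> 0 < chain_count L d rho nu ->
  admissible L nu /\ (d -> L <> [::] -> exists2 j, 0 < j & nu`_j < rho`_j).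
Proof.
elim: L d rho nu => [|[a b] L IHL] d rho nu L_last nu_part.
  by rewrite /= lt0b => /eqP ->; split=> //; split=> // i; rewrite nth_nil.
have L_last' : ~~ (last (0, false) L).2 by case: (L) L_last.
case/chain_count_consP=> ka [ka_part size_nu strip descent chain].
have [[_ ka_dom ka_rows] ka_descent] := IHL b nu ka L_last' ka_part chain.
split=> [|/descent/strip_descentP[i [j [lt_ij _ lt_j]]] _]; last first.
  by exists j; first exact: leq_trans lt_ij.
split=> [||[|i]] //; first exact: hstrip_dominated size_nu ka_dom.
  have := ka_rows 0; rewrite /overlaps_from /cells_from !drop0 /=.
  have := sumn_drop_nth nu 0; have := sumn_drop_nth ka 0; rewrite !drop0.
  case: b L_last ka_descent {chain} => [L_last /(_ isT) ka_descent|_ _]; last first.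
    by have := hstrip_sumn_drop 1 strip; lia.
  have [|j j_gt0 lt_j] := ka_descent; first by case: (L) L_last.
  by have := hstrip_sumn_drop_ltn strip j_gt0 lt_j; lia.
exact: leq_trans (leq_add (hstrip_ge i strip) (leqnn _)) (ka_rows i).
Qed.

Lemma admissible_sumn L nu : admissible L nu -> sumn nu = sumn (row_lengths L).
Proof. by case=> _ [-> _] _. Qed.

Lemma admissible_chain_count L (d : bool) rho nu :
    long_decreasing_rows L -> admissible L nu ->
    (d -> [/\ L <> [::], hstrip rho nu & exists2 j, 0 < j & nu`_j < rho`_j]) ->
  0 < chain_count L d rho nu.
Proof.
elim: L d rho nu => [|[a b] L IHL] d rho nu L_long nu_adm rho_strip.
  have [nu_part _ _] := nu_adm; rewrite /= lt0b; apply/eqP/(partition_sumn0 nu_part).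
  exact: admissible_sumn nu_adm.
have [m [ka [ka_adm strip nu_m ka_m ka_descent]]] := next_strip L_long nu_adm.
have [[nu_part _ _] [ka_part _ _]] := (nu_adm, ka_adm).
apply/chain_count_consP; exists ka; split=> //.
- by rewrite (admissible_sumn nu_adm) (admissible_sumn ka_adm) addnC.
- case/rho_strip=> _ rho_nu [[|j] // _ lt_j].
  apply/strip_descentP; exists m, j.+1; split=> //.
  rewrite ltnNge; apply/negP => /(partition_nth_leq nu_part); rewrite nu_m.
  have := hstrip_ge j rho_nu; have := partition_nth_leq nu_part (leq0n j); lia.
apply: IHL ka_adm _; first exact: long_decreasing_rows_cons L_long.
move=> b_true; split=> //; last exact: ka_descent.
by move=> L0; case/and3P: L_long => _ _; rewrite L0 b_true.
Qed.

(** * The support of a ribbon *)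

Lemma column_length_fromS lam mu i j :
  column_length_from lam mu i j =
  ((i, j) \in diagram lam mu) + column_length_from lam mu i.+1 j.
Proof.
rewrite -(count_uniq_mem _ (diagram_uniq lam mu)) -count_predUI.
rewrite [X in _ = _ + X](eq_count (a2 := pred0)) ?count_pred0 ?addn0 => [|[i' j'] /=].
  by apply: eq_count => -[i' j'] /=; rewrite xpair_eqE; lia.
by rewrite xpair_eqE; lia.
Qed.

Section RibbonSupport.
Variables lam mu : seq nat.
Hypothesis ribbon : long_row_ribbon lam mu.

Let L := ribbon_rows lam mu.

Let lam_part : is_partition lam. Proof. by case: ribbon. Qed.
Let next_row_le i : 1 <= i -> part lam i.+1 <= (part mu i).+1.
Proof. by case: ribbon => _ _ _; apply. Qed.

Let size_L : size L = size lam. Proof. by rewrite size_map size_iota. Qed.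

Let nth_L i : i < size lam ->
  nth (0, false) L i = (part lam i.+1 - part mu i.+1, overlaps_next lam mu i.+1).
Proof. by move=> lt_i; rewrite (nth_map 0) ?size_iota // nth_iota. Qed.

Lemma row_lengths_ribbon_rows : row_lengths L =
  [seq part lam i - part mu i | i <- iota 1 (size lam)].
Proof. by rewrite /row_lengths /unzip1 -map_comp. Qed.

Lemma last_ribbon_rows : ~~ (last (0, false) L).2.
Proof.
rewrite -nth_last size_L; case: (posnP (size lam)) => [size0|size_gt0].
  by rewrite nth_default // size_L size0.
by rewrite nth_L ?prednK // /overlaps_next (part_oversize (ltnSn (size lam))).
Qed.

Lemma column_length_below i j : (i, j) \in diagram lam mu ->
  column_length_from lam mu i.+1 j = ((i.+1, j) \in diagram lam mu).
Proof.
move=> ijD; rewrite -(count_uniq_mem _ (diagram_uniq lam mu)).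
apply: eq_in_count => -[i' j'] cD /=; rewrite xpair_eqE.
apply/andP/andP => [[lt_i /eqP jE]|[/eqP -> ->]] //; subst j'.
by have [-> _ _] := ribbon_column_pair ribbon lt_i ijD cD; rewrite !eqxx.
Qed.

Let full_columns i :=
  count (fun j => column_length_from lam mu i j == 2) (iota 1 (part lam 1)).

Let full_columnsS i : 1 <= i <= size lam ->
  full_columns i = overlaps_next lam mu i + full_columns i.+1.
Proof.
move=> /andP[i_gt0 le_i].
pose overlap_at j := (j == (part mu i).+1) && overlaps_next lam mu i.
have [_ mu_part row_ge2 _] := ribbon; have row_i := row_ge2 i ltac:(lia).
have overlap_cells j :
    overlap_at j = ((i, j) \in diagram lam mu) && ((i.+1, j) \in diagram lam mu).
  rewrite /overlap_at /overlaps_next !mem_diagram i_gt0 /=.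
  have := next_row_le i_gt0; have := part_leq mu_part i_gt0 (leqnSn i); lia.
have overlap_count : count overlap_at (iota 1 (part lam 1)) = overlaps_next lam mu i.
  rewrite /overlap_at; case: (overlaps_next lam mu i).
    rewrite (eq_count (a2 := pred1 (part mu i).+1)) => [|j]; last by rewrite andbT.
    rewrite count_uniq_mem ?iota_uniq // mem_iota.
    by have := part_leq lam_part (leqnn 1) i_gt0; lia.
  by rewrite (eq_count (a2 := pred0)) ?count_pred0 // => j; rewrite andbF.
rewrite -overlap_count /full_columns -count_predUI.
rewrite [X in _ = _ + X](eq_count (a2 := pred0)) ?count_pred0 ?addn0 => [|j /=]; last first.
  by rewrite overlap_cells; apply/negP => /andP[/andP[/column_length_below -> ->]].
apply: eq_count => j /=; rewrite overlap_cells column_length_fromS.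
by case: (boolP ((i, j) \in _)) => //= /column_length_below ->; case: (_ \in _).
Qed.

Let full_columns_last : full_columns (size lam).+1 = 0.
Proof.
rewrite /full_columns (eq_count (a2 := pred0)) ?count_pred0 // => j.
rewrite /column_length_from (eq_in_count (a2 := pred0)) ?count_pred0 // => c.
rewrite diagram_ribbon_reading mem_rows_reading add1n => /andP[/andP[_ lt_c] _] /=.
by rewrite ltnNge -ltnS lt_c.
Qed.

Let full_columns_overlaps i : i <= size lam -> full_columns i.+1 = overlaps_from L i.
Proof.
have [k] := ubnP (size lam - i); elim: k i => // k IHk i lt_k le_i.
have [lt_i|ge_i] := ltnP i (size lam); last first.
  have -> : i = size lam by lia.
  by rewrite full_columns_last /overlaps_from drop_oversize ?size_L.
by rewrite full_columnsS // overlaps_fromS nth_L // IHk //; lia.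
Qed.

Lemma nth_overlapping_partition i : (overlapping_partition lam mu)`_i = overlaps_from L i.
Proof.
have [lt_i|le_i] := ltnP i (size lam).
  by rewrite (nth_map 0) ?size_iota // nth_iota // -full_columns_overlaps // ltnW.
by rewrite nth_default ?size_map ?size_iota // /overlaps_from drop_oversize ?size_L.
Qed.

Let diagram_size : size (diagram lam mu) = sumn (row_lengths L).
Proof. by rewrite row_lengths_ribbon_rows size_diagram. Qed.

Definition ribbon_coef (nu : seq nat) : int :=
  if nu \in partitions (sumn (row_lengths L)) then Posz (chain_count L false [::] nu)
  else 0%R.

Lemma ribbon_schur_expansion : is_schur_expansion lam mu ribbon_coef.
Proof.
rewrite /is_schur_expansion diagram_size.
split=> [n|nu /negbTE nu_out]; last by rewrite /ribbon_coef nu_out.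
rewrite (skew_schur_ribbon ribbon) ribbon_word_sumE ?last_ribbon_rows
  ?row_lengths_ribbon_rows_gt0 //.
apply: eq_big_seq => nu nu_in; have := nu_in; rewrite mem_partitions => /andP[nu_part _].
by rewrite schurE // /ribbon_coef nu_in -natz scaler_nat mulr_natl.
Qed.

Lemma schur_expansion_unique c : is_schur_expansion lam mu c -> c =1 ribbon_coef.
Proof.
have [coef_sum coef_out] := ribbon_schur_expansion.
rewrite diagram_size in coef_sum coef_out.
rewrite /is_schur_expansion diagram_size => -[c_sum c_out] nu.
have [nu_in|nu_out] := boolP (nu \in partitions (sumn (row_lengths L))); last first.
  by rewrite c_out // coef_out.
apply/eqP; rewrite -subr_eq0; apply/eqP.
apply: (schur_independent (d := fun nu => (c nu - ribbon_coef nu)%R) (leqnn _) _ nu_in).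
by under eq_bigr do rewrite scalerBl; rewrite sumrB -c_sum -coef_sum subrr.
Qed.

Lemma in_schur_supportP nu : long_decreasing_rows L ->
  in_schur_support lam mu nu <-> admissible L nu.
Proof.
move=> L_long; split=> [[c [/schur_expansion_unique -> ]]|nu_adm].
  rewrite /ribbon_coef; case: ifP => // nu_in; rewrite ltz_nat => chain.
  move: nu_in; rewrite mem_partitions => /andP[nu_part _].
  by have [] := chain_count_admissible last_ribbon_rows nu_part chain.
exists ribbon_coef; split; first exact: ribbon_schur_expansion.
have [nu_part _ _] := nu_adm.
by rewrite /ribbon_coef mem_partitions nu_part (admissible_sumn nu_adm) eqxx ltz_nat
  admissible_chain_count.
Qed.

End RibbonSupport.

(** * Partitions that violate a row bound *)

(* The [varrho_i] of the theorem, the least length that violates the bound on row [i]. *)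
Definition threshold L i := (cells_from L i).+1 - overlaps_from L i.

Definition in_interval L (nu : seq nat) : Prop :=
  [/\ is_partition nu, dominated (row_lengths L) nu &
      nu`_0 + overlaps_from L 0 <= cells_from L 0].

Lemma admissible_in_interval L nu : admissible L nu -> in_interval L nu.
Proof. by case=> nu_part nu_dom nu_rows; split=> //; apply: nu_rows. Qed.

Lemma sum_maxn_subn (f : nat -> nat) r n :
  \sum_(j < n) maxn (f j) r = \sum_(j < n) f j + \sum_(j < n) (r - f j).
Proof. by rewrite -big_split; apply: eq_bigr => j _; rewrite /= maxnE. Qed.

Lemma sum_maxn_le (f g : nat -> nat) r n : nonincreasing f -> nonincreasing g ->
    (forall k, k <= n -> \sum_(j < k) f j <= \sum_(j < k) g j) -> r <= g n ->
  \sum_(j < n) maxn (f j) r <= \sum_(j < n) g j.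
Proof.
move=> f_dec g_dec; elim: n => [|n IHn] dom le_r; first by rewrite !big_ord0.
have [le_rf|lt_fr] := leqP r (f n).
  rewrite (eq_bigr (fun j : 'I_n.+1 => f j)) ?dom // => j _.
  by apply/maxn_idPl/(leq_trans le_rf)/nonincreasing_leq/(ltn_ord j).
have le_rn : r <= g n := leq_trans le_r (g_dec n).
have := IHn (fun k le_k => dom k (leqW le_k)) le_rn.
by rewrite (sum_ord_recr (fun j => maxn (f j) r)) sum_ord_recr; lia.
Qed.

Section RowBound.
Variable L : ribbon_data.
Hypothesis L_long : long_decreasing_rows L.

Local Notation alpha := (row_lengths L).

Let alpha_dec : nonincreasing (nth 0 alpha).
Proof.
case/and3P: L_long => /(sortedP 0) alpha_sorted _ _ i.
by case: (ltnP i.+1 (size alpha)) => [/alpha_sorted //|?]; rewrite [leqLHS]nth_default.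
Qed.

Let overlaps_le i : overlaps_from L i <= size L - i.+1. Proof. exact: overlaps_from_le. Qed.

Let cells_ge i : 2 * (size L - i) <= cells_from L i. Proof. exact: cells_from_ge. Qed.

Let thresholdE i : threshold L i + overlaps_from L i = (cells_from L i).+1.
Proof. by rewrite subnK //; have := overlaps_le i; have := cells_ge i; lia. Qed.

Lemma row_bound nu i : in_interval L nu ->
    overlaps_from L i <= \sum_(j < i) (threshold L i - alpha`_j) ->
  nu`_i + overlaps_from L i <= cells_from L i.
Proof.
case=> nu_part /dominatedP[nu_sum nu_dom] _ cond; rewrite leqNgt; apply/negP => lt_i.
have le_nu : threshold L i <= nu`_i by have := thresholdE i; lia.
have := sum_maxn_le alpha_dec (partition_nonincreasing nu_part) (fun k _ => nu_dom k) le_nu.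
have := leq_sum_nth_sumn nu i.+1; rewrite sum_ord_recr sum_maxn_subn -nu_sum.
have := sum_nth_sumn_drop alpha i; rewrite -/(cells_from L i); have := thresholdE i; lia.
Qed.

Section Violation.
Variable i : nat.
Hypotheses (i_gt0 : 0 < i) (lt_i : i < size L).
Hypothesis deficit : \sum_(j < i) (threshold L i - alpha`_j) < overlaps_from L i.

Let r := threshold L i.

Let excess := overlaps_from L i - 1 - \sum_(j < i) (r - alpha`_j).

(* The least rows that reach [r] in row [i]; the remaining cells go to the first row. *)
Let rows j := if j < i then maxn alpha`_j r + (if j == 0 then excess else 0)
              else if j == i then r else 0.

Let rows_dec : nonincreasing rows.
Proof.
move=> j; rewrite /rows; have := alpha_dec j; case: (ltnP j.+1 i) => [lt_j|ge_j].
  by rewrite (ltnW lt_j) /= addn0; lia.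
by case: eqP => [<-|_] //; rewrite leqnn; lia.
Qed.

Let rows_end : rows i.+1 = 0.
Proof. by rewrite /rows ltnNge leqnSn (gtn_eqF (ltnSn i)). Qed.

Let sum_rows k : 0 < k <= i -> \sum_(j < k) rows j = \sum_(j < k) maxn alpha`_j r + excess.
Proof.
case: k => // k le_ki; rewrite sum_ord_recl (sum_ord_recl (fun j => maxn alpha`_j r)).
rewrite /rows i_gt0 /= addnAC; congr (_ + _ + _); apply: eq_bigr => j _.
by rewrite (leq_trans _ le_ki) ?ltnS // addn0.
Qed.

Let rows_i : rows i = r. Proof. by rewrite /rows ltnn eqxx. Qed.

Let violator := partition_of rows i.+1.

Let nth_violator j : violator`_j = rows j. Proof. exact: nth_partition_of. Qed.

Let sumn_violator : sumn violator = sumn alpha.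
Proof.
rewrite sumn_partition_of // sum_ord_recr sum_rows ?i_gt0 ?leqnn // rows_i sum_maxn_subn.
rewrite -(sum_nth_sumn_drop alpha i) -/(cells_from L i) /excess /r.
by have := thresholdE i; have := deficit; lia.
Qed.

Let violator_dominates : dominated alpha violator.
Proof.
apply/dominatedP; split=> // k; have [le_ki|lt_ik] := leqP k i; last first.
  by rewrite [leqRHS]sum_nth_sumn ?sumn_violator ?leq_sum_nth_sumn //
    (leq_trans (size_partition_of _ _)).
case: (posnP k) => [->|k_gt0]; first by rewrite !big_ord0.
rewrite [leqRHS](eq_bigr (fun j : 'I_k => rows j)) => [|j _]; last exact: nth_violator.
rewrite sum_rows ?k_gt0 // (leq_trans _ (leq_addr _ _)) // leq_sum // => j _.
exact: leq_maxl.
Qed.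

Let violator_first_row : violator`_0 + overlaps_from L 0 <= cells_from L 0.
Proof.
rewrite nth_violator; have := sum_nonincreasing_ge i rows_dec; rewrite rows_i.
have -> : \sum_(j < i.+1) rows j = cells_from L 0.
  by rewrite -sumn_partition_of // sumn_violator /cells_from drop0.
suff : overlaps_from L 0 <= i * r by lia.
have r_ge : (size L - i).+2 <= r.
  by have := thresholdE i; have := overlaps_le i; have := cells_ge i; lia.
have := leq_mul (leqnn i) r_ge; have := overlaps_le 0; have := leq_pmull (size L - i) i_gt0.
by rewrite !mulnS; lia.
Qed.

Lemma violating_partition :
  exists2 nu, in_interval L nu & cells_from L i < nu`_i + overlaps_from L i.
Proof.
exists violator; last by rewrite nth_violator rows_i; have := thresholdE i; lia.
by split; [apply: partition_of_is_partition | | ].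
Qed.

End Violation.

Lemma interval_admissible_iff :
  (forall nu, in_interval L nu -> admissible L nu) <->
  (forall i, 0 < i -> 0 < overlaps_from L i ->
     overlaps_from L i <= \sum_(j < i) (threshold L i - alpha`_j)).
Proof.
split=> [all_adm i i_gt0 overlaps_i|cond nu nu_int].
  rewrite leqNgt; apply/negP => deficit.
  have lt_i : i < size L by have := overlaps_le i; lia.
  have [nu /all_adm[_ _ /(_ i)] rows_i violation] := violating_partition i_gt0 lt_i deficit.
  by rewrite ltnNge rows_i in violation.
have [nu_part nu_dom nu_row0] := nu_int; split=> // i.
have [-> //|i_gt0] := posnP i; have [overlaps0|overlaps_gt0] := posnP (overlaps_from L i).
  have /dominatedP[nu_sum dom] := nu_dom; rewrite overlaps0 addn0.
  have := leq_sum_nth_sumn nu i.+1; have := dom i; have := sum_nth_sumn_drop alpha i.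
  by rewrite sum_ord_recr -/(cells_from L i) -nu_sum; lia.
exact/row_bound/cond.
Qed.

End RowBound.

(** * The theorem *)

Lemma is_ribbon_long_rows alpha lam mu : all (leq 2) alpha -> is_ribbon alpha lam mu ->
  long_row_ribbon lam mu.
Proof.
move=> alpha_ge2 [[lam_part mu_part _] no_square alphaE _ _].
have row_ge2 i : 1 <= i <= size lam -> part mu i + 2 <= part lam i.
  move=> iP; suff : 2 <= part lam i - part mu i by lia.
  by apply: (allP alpha_ge2); rewrite alphaE; apply: map_f; rewrite mem_iota; lia.
split=> // i i_gt0; rewrite leqNgt; apply/negP => lt_mu.
apply: (no_square i (part mu i).+1).
have := part_leq lam_part i_gt0 (leqnSn i); have := part_leq mu_part i_gt0 (leqnSn i).
by split; rewrite mem_diagram; lia.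
Qed.

Lemma in_dominance_intervalP L nu : long_decreasing_rows L ->
  in_dominance_interval (row_lengths L)
    [:: sumn (row_lengths L) - overlaps_from L 0; overlaps_from L 0] nu
  <-> in_interval L nu.
Proof.
move=> L_long; have overlaps0 : overlaps_from L 0 <= cells_from L 0.
  by have := overlaps_from_le 0 L_long; have := cells_from_ge 0 L_long; lia.
rewrite [sumn _](_ : _ = cells_from L 0); last by rewrite /cells_from drop0.
split=> [[nu_part nu_dom /dominatedP[_ /(_ 1)]]|[nu_part nu_dom row0]].
  by rewrite !big_ord1 /= => row0; split=> //; lia.
have nu_sum : sumn nu = cells_from L 0 by have [<- _] := nu_dom; rewrite /cells_from drop0.
split=> //; apply/dominatedP; split=> [|[|[|k]]]; rewrite ?big_ord0 ?big_ord1 //=.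
- by lia.
- by lia.
apply: leq_trans (leq_sum_nth_sumn nu _) _; rewrite !sum_ord_recl /=; lia.
Qed.

Local Open Scope ring_scope.

Lemma pos_part_subz (r x : nat) : pos_part (r%:Z - x%:Z) = (r - x)%N.
Proof. by rewrite /pos_part; case: leP; lia. Qed.

Lemma sum_partz (s : seq nat) i : (i <= size s)%N ->
  \sum_(i.+1 <= q < (size s).+1) (part s q)%:Z = sumn (drop i s).
Proof.
move=> le_i; rewrite big_add1 /= -(big_morph Posz PoszD (erefl _)); congr Posz.
rewrite sumnE [RHS](big_nth 0%N) size_drop -{1}[i]add0n big_addn.
by apply: eq_bigr => j _; rewrite nth_drop addnC.
Qed.

Lemma varrho_threshold L p i : long_decreasing_rows L -> (i <= size L)%N ->
  (p`_i)%N = overlaps_from L i ->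
  varrho (row_lengths L) p i = threshold L i.
Proof.
move=> L_long le_i pE.
rewrite /varrho sum_partz ?size_map // -/(cells_from L i) /part /= pE.
rewrite /threshold; have := overlaps_from_le i L_long; have := cells_from_ge i L_long; lia.
Qed.

Lemma varrho_conditionE L p i :
    long_decreasing_rows L -> (0 < overlaps_from L i)%N -> (p`_i)%N = overlaps_from L i ->
  ((part p i.+1)%:Z <=
     \sum_(1 <= j < i.+1)
        pos_part (varrho (row_lengths L) p i - (part (row_lengths L) j)%:Z)) =
  (overlaps_from L i <= \sum_(j < i) (threshold L i - nth 0 (row_lengths L) j))%N.
Proof.
move=> L_long overlaps_i pE.
have le_i : (i <= size L)%N by have := overlaps_from_le i L_long; lia.
rewrite varrho_threshold // /part /= pE big_add1 /= big_mkord.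
pose term (j : 'I_i) := (threshold L i - nth 0 (row_lengths L) j)%N.
rewrite (eq_bigr (fun j => Posz (term j))) => [|j _]; last exact: pos_part_subz.
by rewrite -(big_morph Posz PoszD (erefl _)) lez_nat.
Qed.

Local Close Scope ring_scope.

Theorem theorem1p7 (alpha p lam mu : seq nat)
  (alpha_part : is_partition alpha)
  (alpha_ge2 : all (fun a => 2 <= a) alpha)
  (ribbon_alpha : is_ribbon alpha lam mu)
  (p_overlap : p = overlapping_partition lam mu) :
  (forall nu : seq nat,
     in_schur_support lam mu nu <->
     in_dominance_interval alpha [:: sumn alpha - part p 1; part p 1] nu)
  <->
  (num_nonzero p < 2 \/
   (2 <= num_nonzero p /\
    forall i : nat, 1 <= i <= num_nonzero p - 1 ->
      ((part p i.+1)%:Z <=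
       \sum_(1 <= j < i.+1) pos_part (varrho alpha p i - (part alpha j)%:Z))%R)).
Proof.
have ribbon := is_ribbon_long_rows alpha_ge2 ribbon_alpha; pose L := ribbon_rows lam mu.
have alphaE : alpha = row_lengths L.
  by have [_ _ -> _ _] := ribbon_alpha; rewrite row_lengths_ribbon_rows.
have L_long : long_decreasing_rows L.
  rewrite /long_decreasing_rows -alphaE alpha_ge2 last_ribbon_rows.
  by case/andP: alpha_part => ->.
have pE i : p`_i = overlaps_from L i by rewrite p_overlap nth_overlapping_partition.
have num_p i : (i < num_nonzero p) = (0 < overlaps_from L i).
  by rewrite num_nonzero_ltn ?pE // => j; rewrite !pE overlaps_from_dec.
rewrite alphaE (_ : part p 1 = overlaps_from L 0); last exact: pE.
apply: (iff_trans (B := forall nu, in_interval L nu -> admissible L nu)).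
  split=> [full nu|all_adm nu].
    by rewrite -(in_dominance_intervalP _ L_long) -(in_schur_supportP ribbon _ L_long) full.
  rewrite (in_schur_supportP ribbon nu L_long) (in_dominance_intervalP nu L_long).
  by split; [apply: admissible_in_interval | apply: all_adm].
apply: iff_trans (interval_admissible_iff L_long) _.
split=> [cond|cond i i_gt0 overlaps_i]; last first.
  have lt_i : i < num_nonzero p by rewrite num_p.
  by case: cond => [|[_ cond]]; last rewrite -(varrho_conditionE L_long _ (pE i)) //;
    [|apply: cond]; lia.
case: (ltnP (num_nonzero p) 2) => [|ge2]; [by left | right; split=> // i i_range].
have overlaps_i : 0 < overlaps_from L i by rewrite -num_p; lia.
by rewrite varrho_conditionE //; apply: cond; lia.
Qed.
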